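(* Let $p,q$ be nonnegative integers, let $\kappa_1,\dots,\kappa_p,\mu_1,\dots,\mu_q$ be complex numbers none of which is in $\{0,-1,-2,\dots\}$, let $\alpha,\beta\in\mathbb{C}$ with $\Re(\alpha)>0$, let $\lambda_1,\lambda_2,\lambda_3\in\mathbb{C}$ with $\Re(\lambda_3)>\Re(\lambda_2)>0$, let $\rho\in\mathbb{C}$ with $\Re(\rho)>0$, let $z\in\mathbb{C}$, and let $n\in\mathbb{N}$. Then the $n$-th order derivative of the M-Gauss hypergeometric function is $$\frac{d^{n}}{dz^{n}}\left\lbrace {}^{M}F_{p,q}^{(\alpha,\beta)}(\lambda_{1},\lambda_{2};\lambda_{3};z;\rho)\right\rbrace =\frac{(\lambda_1)_{n}(\lambda_2)_{n}}{(\lambda_3)_{n}}\;{}^{M}F_{p,q}^{(\alpha,\beta)}(\lambda_{1}+n,\lambda_{2}+n;\lambda_{3}+n;z;\rho).$$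
   Context: $(\lambda)_m=\Gamma(\lambda+m)/\Gamma(\lambda)$, $(\lambda)_0=1$ is the Pochhammer symbol and $B(x,y)=\int_0^1 t^{x-1}(1-t)^{y-1}dt$ is the classical beta function. The generalized M-series is $${}_{p}^{\alpha}M^{\beta}_{q}(\kappa_{1},\ldots,\kappa_{p};\mu_{1},\ldots,\mu_{q};z)=\sum_{m=0}^{\infty}\frac{(\kappa_{1})_{m}\cdots(\kappa_p)_{m}}{(\mu_1)_{m}\cdots(\mu_q)_{m}}\frac{z^{m}}{\Gamma(\alpha m+\beta)}.$$ With parameters $\kappa_1,\dots,\kappa_p;\mu_1,\dots,\mu_q$ suppressed from the notation, the modified beta (M-beta) and modified Gauss hypergeometric (M-Gauss hypergeometric) functions are $${}^{M}B_{p,q}^{(\alpha,\beta)}(x,y;\rho)=\int_{0}^{1}t^{x-1}(1-t)^{y-1}\,{}_{p}^{\alpha}M^{\beta}_{q}\left(\kappa_{1},\ldots,\kappa_{p};\mu_{1},\ldots,\mu_{q};\frac{-\rho}{t(1-t)}\right) dt,$$ $${}^{M}F_{p,q}^{(\alpha,\beta)}(\lambda_1,\lambda_2;\lambda_3;z;\rho)=\sum_{n=0}^{\infty}(\lambda_1)_{n}\frac{{}^{M}B_{p,q}^{(\alpha,\beta)}(\lambda_2+n,\lambda_3-\lambda_2;\rho)}{B(\lambda_2,\lambda_3-\lambda_2)}\frac{z^{n}}{n!}.$$ These functions are defined for those parameters and arguments for which the series and integrals converge. *)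

(* Defs.v *)
From Stdlib Require Import Reals Factorial List ClassicalEpsilon.
From Coquelicot Require Import Coquelicot.
Open Scope C_scope.

Definition nonpos_int (z : C) : Prop := exists k : nat, z = - RtoC (INR k).

(* Componentwise; these are the limit and the sum whenever the sequence,
   respectively the series, converges in C. *)
Definition CLim_seq (u : nat -> C) : C :=
  (real (Lim_seq (fun n => Re (u n))), real (Lim_seq (fun n => Im (u n)))).

Definition CSeries (a : nat -> C) : C :=
  (Series (fun n => Re (a n)), Series (fun n => Im (a n))).

(* t^w = exp (w ln t), the principal power, for a real base t > 0. *)
Definition RCpower (t : R) (w : C) : C :=
  (exp (Re w * ln t) * cos (Im w * ln t),
   exp (Re w * ln t) * sin (Im w * ln t))%R.

(* z (z + 1) ... (z + m - 1) *)
Fixpoint rising (z : C) (m : nat) : C :=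
  match m with
  | O => 1
  | S m' => rising z m' * (z + RtoC (INR m'))
  end.

(* 1 / Gamma(z) by Gauss's formula
     Gamma(z) = lim_n  n! n^z / (z (z + 1) ... (z + n)).
   Stating it for the entire function 1 / Gamma gives the value 0 at the poles
   of Gamma, as needed in the M-series when alpha m + beta is such a pole. *)
Definition inv_Gamma (z : C) : C :=
  CLim_seq (fun n => rising z (S n) / (RtoC (INR (fact n)) * RCpower (INR n) z)).

Definition CGamma (z : C) : C := / inv_Gamma z.

(* When z is a pole of Gamma the quotient Gamma(z + m) / Gamma(z) is read as its
   limit, the rising factorial. *)
Definition pochhammer (z : C) (m : nat) : C :=
  match m with
  | O => 1
  | S _ =>
      if excluded_middle_informative (nonpos_int z) then rising z m
      else CGamma (z + RtoC (INR m)) / CGamma z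
  end.

Definition pochhammer_prod (l : list C) (m : nat) : C :=
  fold_right Cmult 1 (map (fun k => pochhammer k m) l).

(* Integrals over (0, 1) are improper at both ends. *)
Definition CInt01 (f : R -> C) : C :=
  RInt_gen (V := C_R_CompleteNormedModule) f (at_right 0) (at_left 1).

Definition ex_CInt01 (f : R -> C) : Prop :=
  ex_RInt_gen (V := C_R_NormedModule) f (at_right 0) (at_left 1).

Definition beta_kernel (x y : C) (t : R) : C :=
  RCpower t (x - 1) * RCpower (1 - t) (y - 1).

Definition CBeta (x y : C) : C := CInt01 (beta_kernel x y).

Definition Mseries_term (kappa mu : list C) (alpha beta z : C) (m : nat) : C :=
  pochhammer_prod kappa m / pochhammer_prod mu m
  * (z ^ m * inv_Gamma (alpha * RtoC (INR m) + beta)).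

Definition Mseries (kappa mu : list C) (alpha beta z : C) : C :=
  CSeries (Mseries_term kappa mu alpha beta z).

Definition Mseries_defined (kappa mu : list C) (alpha beta z : C) : Prop :=
  ex_series (V := C_NormedModule) (Mseries_term kappa mu alpha beta z).

Definition MBeta_arg (rho : C) (t : R) : C := - rho / (RtoC t * (1 - RtoC t)).

Definition MBeta_integrand
    (kappa mu : list C) (alpha beta x y rho : C) (t : R) : C :=
  beta_kernel x y t * Mseries kappa mu alpha beta (MBeta_arg rho t).

Definition MBeta (kappa mu : list C) (alpha beta x y rho : C) : C :=
  CInt01 (MBeta_integrand kappa mu alpha beta x y rho).

Definition MBeta_defined (kappa mu : list C) (alpha beta x y rho : C) : Prop :=
  (forall t : R, (0 < t < 1)%R ->
     Mseries_defined kappa mu alpha beta (MBeta_arg rho t)) /\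
  ex_CInt01 (MBeta_integrand kappa mu alpha beta x y rho).

Definition MGauss_term (kappa mu : list C)
    (alpha beta lambda1 lambda2 lambda3 z rho : C) (k : nat) : C :=
  pochhammer lambda1 k
  * (MBeta kappa mu alpha beta (lambda2 + RtoC (INR k)) (lambda3 - lambda2) rho
     / CBeta lambda2 (lambda3 - lambda2))
  * (z ^ k / RtoC (INR (fact k))).

Definition MGauss (kappa mu : list C)
    (alpha beta lambda1 lambda2 lambda3 z rho : C) : C :=
  CSeries (MGauss_term kappa mu alpha beta lambda1 lambda2 lambda3 z rho).

Definition MGauss_defined (kappa mu : list C)
    (alpha beta lambda1 lambda2 lambda3 z rho : C) : Prop :=
  (forall k : nat,
     MBeta_defined kappa mu alpha beta
       (lambda2 + RtoC (INR k)) (lambda3 - lambda2) rho) /\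
  ex_series (V := C_NormedModule)
    (MGauss_term kappa mu alpha beta lambda1 lambda2 lambda3 z rho).

(* f is n times complex differentiable at z, with n-th derivative l there: the
   derivatives of order < n exist near z, and g is the one of order n - 1. *)
Fixpoint is_C_derive_n (f : C -> C) (n : nat) (z l : C) : Prop :=
  match n with
  | O => f z = l
  | S n' =>
      exists g : C -> C,
        locally z (fun w => is_C_derive_n f n' w (g w)) /\
        is_derive (K := C_AbsRing) (V := C_NormedModule) g z l
  end.

(* Main.v *)
(** The coefficients of the power series in [z] contain the Beta-type integrals only
    through [lambda2 + k] and [lambda3 - lambda2], which are unchanged when all
    parameters are raised by [n] and [k] is lowered by [n]; so differentiating [n]
    times termwise reproduces the same series up to the constant
    [(lambda1)_n B(lambda2 + n, lambda3 - lambda2) / B(lambda2, lambda3 - lambda2)],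
    and integrating the derivative of [t^x (1 - t)^y] over (0, 1) evaluates the
    quotient of Beta values as [(lambda2)_n / (lambda3)_n].  Convergence in a
    neighbourhood of [z] gives a point of convergence of larger modulus, hence
    absolute convergence around [z].  Finally, Gauss's product converges, and to a
    nonzero limit off the poles, because consecutive terms have ratio
    [1 + O(1/n^2)]; this turns quotients of Gamma values into rising factorials. *)

Require Import Defs.
From Stdlib Require Import Reals Factorial List Lra Lia ClassicalEpsilon.
From Coquelicot Require Import Coquelicot.
Open Scope C_scope.

(** * Limits of complex sequences *)

(** Componentwise with finite limits, to match [CLim_seq]: a proved limit can then be rewritten as
    the value of [CLim_seq], which by itself carries no convergence. *)
Definition is_Clim (u : nat -> C) (l : C) : Prop :=
  is_lim_seq (fun n => Re (u n)) (Re l) /\ is_lim_seq (fun n => Im (u n)) (Im l).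

Lemma C_ext (x y : C) : Re x = Re y -> Im x = Im y -> x = y.
Proof. destruct x, y; simpl; congruence. Qed.

Lemma CLim_seq_unique (u : nat -> C) (l : C) : is_Clim u l -> CLim_seq u = l.
Proof.
  intros [H1 H2]; unfold CLim_seq.
  rewrite (is_lim_seq_unique _ _ H1), (is_lim_seq_unique _ _ H2).
  now destruct l.
Qed.

Lemma is_Clim_unique (u : nat -> C) (l l' : C) :
  is_Clim u l -> is_Clim u l' -> l = l'.
Proof.
  intros H H'.
  now rewrite <- (CLim_seq_unique _ _ H), <- (CLim_seq_unique _ _ H').
Qed.

Lemma is_Clim_const (c : C) : is_Clim (fun _ => c) c.
Proof. split; apply is_lim_seq_const. Qed.

Lemma is_Clim_mult (u v : nat -> C) (l m : C) :
  is_Clim u l -> is_Clim v m -> is_Clim (fun n => u n * v n) (l * m).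
Proof.
  intros [u1 u2] [v1 v2]; split; simpl.
  - apply is_lim_seq_minus'; now apply is_lim_seq_mult'.
  - apply is_lim_seq_plus'; now apply is_lim_seq_mult'.
Qed.

Lemma is_Clim_plus (u v : nat -> C) (l m : C) :
  is_Clim u l -> is_Clim v m -> is_Clim (fun n => u n + v n) (l + m).
Proof.
  intros [u1 u2] [v1 v2]; split; simpl; now apply is_lim_seq_plus'.
Qed.

Lemma is_Clim_RtoC (u : nat -> R) (l : R) :
  is_lim_seq u l -> is_Clim (fun n => RtoC (u n)) (RtoC l).
Proof.
  intros H; split; simpl.
  - exact H.
  - apply is_lim_seq_const.
Qed.

Lemma is_Clim_ext_loc (u v : nat -> C) (l : C) :
  eventually (fun n => u n = v n) -> is_Clim u l -> is_Clim v l.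
Proof.
  intros E [H1 H2]; split;
    (eapply is_lim_seq_ext_loc; [ | eassumption ]);
    revert E; apply filter_imp; intros n ->; reflexivity.
Qed.

Lemma is_Clim_incr_n (u : nat -> C) (N : nat) (l : C) :
  is_Clim u l <-> is_Clim (fun n => u (n + N)%nat) l.
Proof.
  unfold is_Clim.
  rewrite (is_lim_seq_incr_n (fun n => Re (u n)) N).
  rewrite (is_lim_seq_incr_n (fun n => Im (u n)) N).
  tauto.
Qed.

Lemma Rabs_Im_le_Cmod (z : C) : (Rabs (Im z) <= Cmod z)%R.
Proof. exact (Rle_trans _ _ _ (Rmax_r _ _) (Rmax_Cmod z)). Qed.

Lemma Cmod_le_Rabs (z : C) : (Cmod z <= Rabs (Re z) + Rabs (Im z))%R.
Proof.
  replace z with (RtoC (Re z) + Ci * RtoC (Im z)) at 1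
    by (apply C_ext; simpl; ring).
  eapply Rle_trans; [apply Cmod_triangle|].
  rewrite Cmod_mult, Cmod_Ci, !Cmod_R; lra.
Qed.

Lemma ex_lim_seq_summable_increments (u : nat -> R) :
  ex_series (fun n => u (S n) - u n)%R -> ex_finite_lim_seq u.
Proof.
  intros [l Hl].
  exists (l + u 0%nat)%R.
  (* The partial sum of increments through index n telescopes to [u (S n) - u 0], hence the shift by
     one. *)
  apply is_lim_seq_incr_1.
  apply is_lim_seq_ext with
    (fun n => sum_n (fun n => u (S n) - u n)%R n + u 0%nat)%R.
  - intros n; induction n as [|n IH].
    + rewrite sum_O; ring.
    + rewrite sum_Sn. unfold plus; simpl. lra.
  - apply is_lim_seq_plus'.
    + exact Hl.
    + apply is_lim_seq_const.
Qed.

Lemma exp_le_mono (x y : R) : (x <= y)%R -> (exp x <= exp y)%R.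
Proof. intros [H| ->]; [left; now apply exp_increasing | apply Rle_refl]. Qed.

(** Here |ln s| is at most ln 2, which bounds s^c uniformly whatever the sign of c. It controls the
    factor of a kernel that stays away from its singular end. *)
Lemma exp_mul_ln_bound (c s : R) :
  (/ 2 <= s <= 1)%R -> (exp (c * ln s) <= exp (Rabs c * ln 2))%R.
Proof.
  intros Hs; apply exp_le_mono.
  assert (L1 : (ln s <= 0)%R) by (rewrite <- ln_1; apply ln_le; lra).
  assert (L2 : (- ln 2 <= ln s)%R) by (rewrite <- ln_Rinv by lra; apply ln_le; lra).
  pose proof (Rle_abs c); pose proof (Rle_abs (- c)).
  rewrite Rabs_Ropp in *; nra.
Qed.

Lemma exp_mul_ln_le_1 (c s : R) :
  (0 < c)%R -> (0 < s <= 1)%R -> (exp (c * ln s) <= 1)%R.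
Proof.
  intros Hc Hs; rewrite <- exp_0; apply exp_le_mono.
  assert (L : (ln s <= 0)%R) by (rewrite <- ln_1; apply ln_le; lra); nra.
Qed.

(* Comparison with the product of the factors [1 + c n <= exp (c n)] bounds [v],
   and then its increments are summable. *)
Lemma ex_Clim_relative_increments (v : nat -> C) (c : nat -> R) :
  (forall n, Cmod (v (S n) - v n) <= c n * Cmod (v n))%R ->
  (forall n, 0 <= c n)%R ->
  ex_series c -> exists l, is_Clim v l.
Proof.
  intros Hv Hc Hs.
  assert (HB : forall n, (Cmod (v (S n)) <= Cmod (v 0%nat) * exp (sum_n c n))%R).
  { assert (step : forall n, (Cmod (v (S n)) <= Cmod (v n) * exp (c n))%R).
    { intros n.
      replace (v (S n)) with (v n + (v (S n) - v n)) by ring.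
      eapply Rle_trans; [apply Cmod_triangle|].
      specialize (Hv n).
      pose proof (exp_ineq1_le (c n)); pose proof (Cmod_ge_0 (v n)); nra. }
    intros n; induction n as [|n IH].
    - rewrite sum_O; apply step.
    - rewrite sum_Sn; unfold plus; simpl; rewrite exp_plus.
      eapply Rle_trans; [apply step|].
      pose proof (exp_pos (c (S n))); nra. }
  assert (Hle : forall n, (sum_n c n <= Series c)%R).
  { intros n.
    apply is_lim_seq_incr_compare with (u := sum_n c).
    - exact (Series_correct _ Hs).
    - intros k; rewrite sum_Sn; unfold plus; simpl; specialize (Hc (S k)); lra. }
  set (M := (Cmod (v 0%nat) * exp (Series c))%R).
  assert (HM : forall n, (Cmod (v n) <= M)%R).
  { assert (exp0 : forall n, (exp (sum_n c n) <= exp (Series c))%R)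
      by (intros n; apply exp_le_mono, Hle).
    pose proof (Cmod_ge_0 (v 0%nat)) as H0.
    (* [HB] speaks of successors only; index 0 needs [exp (Series c)] to be at least 1. *)
    intros [|n]; unfold M.
    - assert (H : (1 <= exp (Series c))%R); [|nra].
      rewrite <- exp_0; eapply Rle_trans; [|apply (exp0 0%nat)].
      rewrite sum_O; apply exp_le_mono, Hc.
    - eapply Rle_trans; [apply HB|]; specialize (exp0 n); nra. }
  assert (Hsum : ex_series (fun n => M * c n)%R)
    by (apply (ex_series_scal M c), Hs).
  assert (Hinc : forall n, (Cmod (v (S n) - v n) <= M * c n)%R).
  { intros n; eapply Rle_trans; [apply Hv|].
    specialize (HM n); specialize (Hc n); nra. }
  destruct (ex_lim_seq_summable_increments (fun n => Re (v n))) as [l1 H1].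
  { apply (ex_series_le (K := R_AbsRing) (V := R_CompleteNormedModule)) with (2 := Hsum).
    intros n; eapply Rle_trans; [|apply Hinc].
    apply (re_le_Cmod (v (S n) - v n)). }
  destruct (ex_lim_seq_summable_increments (fun n => Im (v n))) as [l2 H2].
  { apply (ex_series_le (K := R_AbsRing) (V := R_CompleteNormedModule)) with (2 := Hsum).
    intros n; eapply Rle_trans; [|apply Hinc].
    apply (Rabs_Im_le_Cmod (v (S n) - v n)). }
  exists (l1, l2); split; assumption.
Qed.

(** * Complex powers of a real variable *)

(** Two real derivatives, so that [auto_derive], the mean value theorem and the fundamental theorem
    of calculus apply to each component. *)
Definition is_Cderive (f : R -> C) (t : R) (l : C) : Prop :=
  is_derive (fun s => Re (f s)) t (Re l) /\ is_derive (fun s => Im (f s)) t (Im l).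

Lemma is_Cderive_mult (f g : R -> C) (t : R) (l m : C) :
  is_Cderive f t l -> is_Cderive g t m ->
  is_Cderive (fun s => f s * g s) t (l * g t + f t * m).
Proof.
  intros [f1 f2] [g1 g2]; split; simpl.
  - evar_last.
    + apply (is_derive_minus (V := R_NormedModule));
        apply is_derive_Reals, derivable_pt_lim_mult; apply is_derive_Reals; eassumption.
    + unfold minus, plus, opp, Re, Im; simpl; ring.
  - evar_last.
    + apply (is_derive_plus (V := R_NormedModule));
        apply is_derive_Reals, derivable_pt_lim_mult; apply is_derive_Reals; eassumption.
    + unfold plus, Re, Im; simpl; ring.
Qed.

Lemma is_Cderive_RCpower (w : C) (t : R) :
  (0 < t)%R -> is_Cderive (fun s => RCpower s w) t (w * RCpower t (w - 1)).
Proof.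
  intros Ht.
  assert (E : exp ((Re w - 1) * ln t)%R = (exp (Re w * ln t) * / t)%R).
  { rewrite <- (exp_ln (/ t)) at 1 by now apply Rinv_0_lt_compat.
    rewrite <- exp_plus, ln_Rinv by assumption; f_equal; ring. }
  destruct w as [a b]; unfold RCpower; split; simpl in *;
    unfold Rminus in *; rewrite E, ?Ropp_0, ?Rplus_0_r;
    (auto_derive; [now repeat split | field; lra]).
Qed.

Lemma is_Cderive_RCpower_one_minus (w : C) (t : R) :
  (t < 1)%R ->
  is_Cderive (fun s => RCpower (1 - s) w) t (- (w * RCpower (1 - t) (w - 1))).
Proof.
  intros Ht; destruct (is_Cderive_RCpower w (1 - t)%R) as [H1 H2]; [lra|].
  assert (D : is_derive (fun s => 1 - s)%R t (-1)%R) by (auto_derive; trivial; ring).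
  split.
  - evar_last; [apply (is_derive_comp (fun s => Re (RCpower s w))); eassumption|].
    unfold scal, Re, Im; simpl; unfold mult; simpl; ring.
  - evar_last; [apply (is_derive_comp (fun s => Im (RCpower s w))); eassumption|].
    unfold scal, Re, Im; simpl; unfold mult; simpl; ring.
Qed.

Lemma is_Cderive_affine (z : C) (t : R) : is_Cderive (fun s => 1 + z * RtoC s) t z.
Proof. destruct z; split; simpl; auto_derive; trivial; ring. Qed.

Lemma Cmod_RCpower (t : R) (w : C) : Cmod (RCpower t w) = exp (Re w * ln t).
Proof.
  unfold Cmod, RCpower; simpl fst; simpl snd.
  replace (_ + _)%R with ((exp (Re w * ln t)) * (exp (Re w * ln t)))%R.
  - apply sqrt_square; left; apply exp_pos.
  - pose proof (sin2_cos2 (Im w * ln t)); unfold Rsqr in *; nra.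
Qed.

Lemma RCpower_neq_0 (t : R) (w : C) : RCpower t w <> 0.
Proof.
  apply Cmod_gt_0; rewrite Cmod_RCpower; apply exp_pos.
Qed.

Lemma RCpower_plus (t : R) (v w : C) :
  RCpower t (v + w) = RCpower t v * RCpower t w.
Proof.
  destruct v, w; unfold RCpower; apply C_ext; simpl;
    rewrite !Rmult_plus_distr_r, exp_plus, ?cos_plus, ?sin_plus; ring.
Qed.

Lemma RCpower_mult_base (s t : R) (w : C) :
  (0 < s)%R -> (0 < t)%R -> RCpower (s * t) w = RCpower s w * RCpower t w.
Proof.
  intros Hs Ht; destruct w; unfold RCpower; rewrite ln_mult by assumption.
  apply C_ext; simpl;
    rewrite !Rmult_plus_distr_l, exp_plus, ?cos_plus, ?sin_plus; ring.
Qed.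

Lemma RCpower_1_r (t : R) : (0 < t)%R -> RCpower t 1 = RtoC t.
Proof.
  intros Ht; unfold RCpower; apply C_ext; simpl;
    rewrite Rmult_1_l, exp_ln, Rmult_0_l, ?cos_0, ?sin_0 by assumption; ring.
Qed.

Lemma RCpower_1_l (w : C) : RCpower 1 w = 1.
Proof.
  unfold RCpower; apply C_ext; simpl;
    rewrite ln_1, !Rmult_0_r, exp_0, ?cos_0, ?sin_0; ring.
Qed.

(** * Gauss's product for the reciprocal Gamma function *)

Definition gauss_seq (z : C) (n : nat) : C :=
  rising z (S n) / (RtoC (INR (fact n)) * RCpower (INR n) z).

(** The quotient of consecutive terms of [gauss_seq], with 1/(n + 1) replaced by a real variable [s]
    so that it can be expanded at [s = 0]. *)
Definition gauss_ratio (z : C) (s : R) : C := (1 + z * RtoC s) * RCpower (1 - s) z.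

Lemma RtoC_INR_S (n : nat) : RtoC (INR (S n)) = RtoC (INR n) + 1.
Proof. now rewrite S_INR, RtoC_plus. Qed.

Lemma RtoC_neq_0 (x : R) : x <> 0%R -> RtoC x <> 0.
Proof. intros H E; now apply H, RtoC_inj. Qed.

Lemma RtoC_INR_S_neq_0 (n : nat) : RtoC (INR (S n)) <> 0.
Proof. apply RtoC_neq_0, not_0_INR; lia. Qed.

Lemma RtoC_INR_fact_neq_0 (n : nat) : RtoC (INR (fact n)) <> 0.
Proof. apply RtoC_neq_0, INR_fact_neq_0. Qed.

Lemma Cinv_neq_0 (z : C) : z <> 0 -> / z <> 0.
Proof.
  intros Hz; apply Cmod_gt_0; rewrite Cmod_inv by assumption.
  now apply Rinv_0_lt_compat, Cmod_gt_0.
Qed.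

(** Since 1 - 1/(n + 1) = n/(n + 1), the power n^z splits as (n + 1)^z (1 - 1/(n + 1))^z. Powers are
    multiplicative for positive bases, which excludes n = 0. *)
Lemma gauss_seq_S (z : C) (n : nat) :
  (1 <= n)%nat ->
  gauss_seq z (S n) = gauss_seq z n * gauss_ratio z (/ INR (S n)).
Proof.
  intros Hn; unfold gauss_seq, gauss_ratio.
  assert (H0 : (0 < INR n)%R) by (apply lt_0_INR; lia).
  assert (H1 : (0 < INR (S n))%R) by (apply lt_0_INR; lia).
  assert (E : (1 - / INR (S n) = INR n * / INR (S n))%R)
    by (rewrite S_INR in *; field; lra).
  assert (P : RCpower (INR n) z = RCpower (INR (S n)) z * RCpower (1 - / INR (S n)) z).
  { rewrite <- RCpower_mult_base; trivial.
    - f_equal; rewrite E; field; lra.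
    - rewrite E; apply Rmult_lt_0_compat; trivial; now apply Rinv_0_lt_compat. }
  rewrite P, RtoC_inv by lra.
  rewrite fact_simpl, mult_INR, RtoC_mult.
  change (rising z (S (S n))) with (rising z (S n) * (z + RtoC (INR (S n)))).
  pose proof (RtoC_INR_S_neq_0 n).
  pose proof (RtoC_INR_fact_neq_0 n).
  pose proof (RCpower_neq_0 (INR (S n)) z).
  pose proof (RCpower_neq_0 (1 - / INR (S n)) z).
  set (r := rising z (S n)); field; repeat split; assumption.
Qed.

(** After (1 - s)^(z-1) is factored out, the product rule leaves z (1 - s) - z (1 + z s), whose
    constant terms cancel. The remaining factor [s] is what makes the ratio 1 + O(s^2). *)
Lemma is_Cderive_gauss_ratio (z : C) (s : R) :
  (s < 1)%R ->
  is_Cderive (gauss_ratio z) s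
    (- (z * (z + 1)) * RtoC s * RCpower (1 - s) (z - 1)).
Proof.
  intros Hs.
  pose proof (is_Cderive_mult _ _ _ _ _ (is_Cderive_affine z s)
                (is_Cderive_RCpower_one_minus z s Hs)) as H.
  replace (- (z * (z + 1)) * RtoC s * RCpower (1 - s) (z - 1)) with
    (z * RCpower (1 - s) z + (1 + z * RtoC s) * - (z * RCpower (1 - s) (z - 1))).
  - exact H.
  - replace (RCpower (1 - s) z) with (RCpower (1 - s) (z - 1) * RtoC (1 - s)).
    + rewrite RtoC_minus; ring.
    + rewrite <- (RCpower_1_r (1 - s)) by lra.
      rewrite <- RCpower_plus; f_equal; ring.
Qed.

(** The derivative is O(s), so the mean value theorem gives O(s^2). That theorem holds for real
    functions only, so it is applied through a functional [f], later [Re] and [Im]; adding the two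
    bounds doubles the constant. *)
Lemma gauss_ratio_bound (z : C) :
  exists K, (0 <= K)%R /\
    forall s, (0 <= s <= / 2)%R -> (Cmod (gauss_ratio z s - 1) <= K * s ^ 2)%R.
Proof.
  set (K := (Cmod (z * (z + 1)) * exp (Rabs (Re z - 1) * ln 2))%R).
  assert (HK : (0 <= K)%R).
  { unfold K; apply Rmult_le_pos; [apply Cmod_ge_0 | left; apply exp_pos]. }
  exists (2 * K)%R; split; [lra|].
  intros s Hs.
  set (d := fun c : R => - (z * (z + 1)) * RtoC c * RCpower (1 - c) (z - 1)).
  assert (Hd : forall c, (0 <= c <= s)%R -> (Cmod (d c) <= K * s)%R).
  { intros c Hc; unfold d.
    rewrite !Cmod_mult, Cmod_opp, Cmod_R, Cmod_RCpower, Rabs_right by lra.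
    assert (E : (exp (Re (z - 1) * ln (1 - c)) <= exp (Rabs (Re z - 1) * ln 2))%R).
    { replace (Re (z - 1)) with (Re z - 1)%R by (destruct z; simpl; ring).
      apply exp_mul_ln_bound; lra. }
    unfold K; rewrite !(Rmult_assoc (Cmod _)).
    apply Rmult_le_compat_l; [apply Cmod_ge_0|].
    pose proof (exp_pos (Re (z - 1) * ln (1 - c))); nra. }
  assert (G0 : gauss_ratio z 0 = 1).
  { unfold gauss_ratio; rewrite Rminus_0_r, RCpower_1_l; ring. }
  assert (M : forall f : C -> R,
    (forall w, Rabs (f w) <= Cmod w)%R ->
    (forall c, (c < 1)%R -> is_derive (fun c => f (gauss_ratio z c)) c (f (d c))) ->
    (Rabs (f (gauss_ratio z s) - f 1) <= K * s ^ 2)%R).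
  { intros f Hf Df.
    destruct (MVT_gen (fun c => f (gauss_ratio z c)) 0 s (fun c => f (d c)))
      as [c [Hc E]].
    - rewrite Rmin_left, Rmax_right by lra; intros c Hc; apply Df; lra.
    - rewrite Rmin_left, Rmax_right by lra; intros c Hc.
      apply derivable_continuous_pt; exists (f (d c)); apply is_derive_Reals, Df; lra.
    - rewrite Rmin_left, Rmax_right in Hc by lra.
      rewrite G0 in E; rewrite E, Rabs_mult, Rminus_0_r, (Rabs_right s) by lra.
      specialize (Hd c Hc); specialize (Hf (d c)); nra. }
  eapply Rle_trans; [apply Cmod_le_Rabs|].
  pose proof (M Re re_le_Cmod (fun c H => proj1 (is_Cderive_gauss_ratio z c H))).
  pose proof (M Im Rabs_Im_le_Cmod (fun c H => proj2 (is_Cderive_gauss_ratio z c H))).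
  change (Re (gauss_ratio z s - 1)) with (Re (gauss_ratio z s) - Re 1)%R.
  change (Im (gauss_ratio z s - 1)) with (Im (gauss_ratio z s) - Im 1)%R.
  lra.
Qed.

Lemma is_lim_seq_inv_INR_S : is_lim_seq (fun n => / INR (S n))%R 0%R.
Proof.
  apply (is_lim_seq_incr_1 (fun n => / INR n)%R).
  replace (Finite 0) with (Rbar_inv p_infty) by reflexivity.
  apply is_lim_seq_inv; [apply is_lim_seq_INR | discriminate].
Qed.

(** Comparison with the telescoping series of 1/((n + 1)(n + 2)). The shift [N] serves tails of the
    Gauss sequence. *)
Lemma ex_series_inv_sq (N : nat) :
  ex_series (fun n => (/ INR (S (S (n + N)))) ^ 2)%R.
Proof.
  assert (T : ex_series (fun n => / INR (S n) - / INR (S (S n)))%R).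
  { exists 1%R.
    change (is_lim_seq (sum_n (fun n => / INR (S n) - / INR (S (S n)))%R) 1%R).
    apply (is_lim_seq_ext (fun n => 1 - / INR (S (S n)))%R).
    - intros n; induction n as [|n IH].
      + rewrite sum_O; simpl; lra.
      + rewrite sum_Sn, <- IH; unfold plus; simpl; lra.
    - evar_last.
      + apply is_lim_seq_minus'; [apply is_lim_seq_const|].
        apply (is_lim_seq_incr_1 (fun n => / INR (S n))%R), is_lim_seq_inv_INR_S.
      + f_equal; ring. }
  apply (ex_series_le (K := R_AbsRing) (V := R_CompleteNormedModule)) with (2 := T).
  intros n; change (Rabs ((/ INR (S (S (n + N)))) ^ 2)
                    <= / INR (S n) - / INR (S (S n)))%R.
  rewrite Rabs_right by (apply Rle_ge, pow2_ge_0).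
  rewrite !S_INR, plus_INR.
  pose proof (pos_INR n); pose proof (pos_INR N).
  set (x := INR n) in *; set (y := INR N) in *.
  apply Rle_trans with ((/ (x + 1 + 1)) ^ 2)%R.
  - apply pow_incr; split.
    + left; apply Rinv_0_lt_compat; lra.
    + apply Rinv_le_contravar; lra.
  - replace (/ (x + 1) - / (x + 1 + 1))%R with (/ (x + 1) * / (x + 1 + 1))%R
      by (field; lra).
    assert (0 < / (x + 1 + 1))%R by (apply Rinv_0_lt_compat; lra).
    assert (/ (x + 1 + 1) <= / (x + 1))%R by (apply Rinv_le_contravar; lra).
    nra.
Qed.

Lemma inv_INR_SS_bound (n : nat) : (0 < / INR (S (S n)) <= / 2)%R.
Proof.
  rewrite !S_INR; pose proof (pos_INR n); split.
  - apply Rinv_0_lt_compat; lra.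
  - apply Rinv_le_contravar; lra.
Qed.

Lemma ex_Clim_gauss_seq (z : C) : exists l, is_Clim (gauss_seq z) l.
Proof.
  destruct (gauss_ratio_bound z) as [K [HK HB]].
  (* Starting at index 1 makes [gauss_seq_S] available and keeps s = 1/(n + 2) within the range of
     [gauss_ratio_bound]. *)
  destruct (ex_Clim_relative_increments (fun n => gauss_seq z (n + 1))
              (fun n => K * (/ INR (S (S (n + 0)))) ^ 2)%R) as [l Hl].
  - intros n; cbv beta; rewrite Nat.add_0_r, !Nat.add_1_r, gauss_seq_S by lia.
    replace (gauss_seq z (S n) * gauss_ratio z (/ INR (S (S n))) - gauss_seq z (S n))
      with ((gauss_ratio z (/ INR (S (S n))) - 1) * gauss_seq z (S n)) by ring.
    rewrite Cmod_mult; apply Rmult_le_compat_r; [apply Cmod_ge_0|].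
    apply HB; pose proof (inv_INR_SS_bound n); lra.
  - intros n; apply Rmult_le_pos; [assumption | apply pow2_ge_0].
  - apply (ex_series_scal K (fun n => (/ INR (S (S (n + 0)))) ^ 2)%R), ex_series_inv_sq.
  - exists l; now apply (is_Clim_incr_n _ 1).
Qed.

Lemma is_Clim_gauss_seq (z : C) : is_Clim (gauss_seq z) (inv_Gamma z).
Proof.
  destruct (ex_Clim_gauss_seq z) as [l Hl].
  unfold inv_Gamma; fold (gauss_seq z).
  now rewrite (CLim_seq_unique (gauss_seq z) l Hl).
Qed.

Lemma rising_neq_0 (z : C) (m : nat) : ~ nonpos_int z -> rising z m <> 0.
Proof.
  intros Hz; induction m as [|m IH]; simpl.
  - exact C1_nz.
  - apply Cmult_neq_0; trivial.
    intros E; apply Hz; exists m.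
    replace z with (z + RtoC (INR m) - RtoC (INR m)) by ring; rewrite E; ring.
Qed.

Lemma gauss_seq_neq_0 (z : C) (n : nat) : ~ nonpos_int z -> gauss_seq z n <> 0.
Proof.
  intros Hz; unfold gauss_seq, Cdiv.
  apply Cmult_neq_0; [now apply rising_neq_0|].
  apply Cinv_neq_0, Cmult_neq_0; [apply RtoC_INR_fact_neq_0 | apply RCpower_neq_0].
Qed.

(* The reciprocals of the Gauss sequence converge as well, for the same reason
   as the sequence itself. *)
Lemma inv_Gamma_neq_0 (z : C) : ~ nonpos_int z -> inv_Gamma z <> 0.
Proof.
  intros Hz.
  destruct (gauss_ratio_bound z) as [K [HK HB]].
  (* Beyond this index K s^2 is at most 1/2, so the ratio has modulus at least 1/2 and can be
     inverted at the cost of a factor 2. *)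
  destruct (INR_unbounded (2 * K)) as [N HN].
  destruct (ex_Clim_relative_increments (fun n => / gauss_seq z (n + S N))
              (fun n => (2 * K) * (/ INR (S (S (n + N)))) ^ 2)%R) as [l Hl].
  - intros n; cbv beta; rewrite Nat.add_succ_l, gauss_seq_S by lia.
    rewrite Nat.add_succ_r.
    pose proof (inv_INR_SS_bound (n + N)) as Hs.
    set (s := (/ INR (S (S (n + N))))%R) in *.
    assert (Ks : (K * s ^ 2 <= / 2)%R).
    { assert (Es : (s * INR (S (S (n + N))) = 1)%R)
        by (apply Rinv_l, not_0_INR; lia).
      rewrite !S_INR, plus_INR in Es; pose proof (pos_INR n); pose proof (pos_INR N).
      assert (s * INR N <= 1)%R by nra.
      assert (2 * K * s <= 1)%R by nra.
      nra. }
    specialize (HB s ltac:(lra)).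
    set (r := gauss_ratio z s) in *.
    assert (Hr : (/ 2 <= Cmod r)%R).
    { pose proof (Cmod_triangle r (- (r - 1))) as T.
      replace (r + - (r - 1)) with (RtoC 1) in T by ring.
      rewrite Cmod_1, Cmod_opp in T; lra. }
    assert (r0 : r <> 0) by (apply Cmod_gt_0; lra).
    pose proof (gauss_seq_neq_0 z (S (n + N)) Hz) as g0.
    set (g := gauss_seq z (S (n + N))) in *.
    (* The relative increment of the reciprocals is -(r - 1)/r, again O(s^2). *)
    replace (/ (g * r) - / g) with (- (r - 1) * / r * / g) by (field; tauto).
    rewrite !Cmod_mult, Cmod_opp, (Cmod_inv r r0).
    apply Rmult_le_compat_r; [apply Cmod_ge_0|].
    assert (I : (0 < / Cmod r <= 2)%R).
    { split; [apply Rinv_0_lt_compat; lra|].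
      rewrite <- (Rinv_inv 2); apply Rinv_le_contravar; lra. }
    pose proof (Cmod_ge_0 (r - 1)); nra.
  - intros n; apply Rmult_le_pos; [lra | apply pow2_ge_0].
  - apply (ex_series_scal (2 * K)%R (fun n => (/ INR (S (S (n + N)))) ^ 2)%R), ex_series_inv_sq.
  (* A zero limit would force the products of the terms with their reciprocals, all equal to 1, to
     tend to 0. *)
  - intros E0.
    assert (H1 : is_Clim (fun n => gauss_seq z n * / gauss_seq z n) (inv_Gamma z * l)).
    { apply is_Clim_mult; [apply is_Clim_gauss_seq|].
      now apply (is_Clim_incr_n _ (S N)). }
    assert (H2 : is_Clim (fun n => gauss_seq z n * / gauss_seq z n) 1).
    { apply is_Clim_ext_loc with (2 := is_Clim_const 1).
      exists 0%nat; intros n _; symmetry; now apply Cinv_r, gauss_seq_neq_0. }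
    apply C1_nz; rewrite (is_Clim_unique _ _ _ H2 H1), E0; ring.
Qed.

(** * Functional equation of Gamma and rising factorials *)

Lemma rising_S_l (z : C) (m : nat) : rising z (S m) = z * rising (z + 1) m.
Proof.
  induction m as [|m IH].
  - simpl; ring.
  - change (rising z (S (S m))) with (rising z (S m) * (z + RtoC (INR (S m)))).
    rewrite IH, RtoC_INR_S; simpl; ring.
Qed.

(** For n at least 1, [z * gauss_seq (z + 1) n] equals [gauss_seq z n] times 1 + (z + 1)/n, and the
    last factor tends to 1; the limits of both sides agree. *)
Lemma inv_Gamma_S (z : C) : inv_Gamma z = z * inv_Gamma (z + 1).
Proof.
  apply is_Clim_unique with (fun n => gauss_seq z n * (1 + (z + 1) * RtoC (/ INR n))).
  - replace (inv_Gamma z) with (inv_Gamma z * (1 + (z + 1) * RtoC 0)) at 1 by ring.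
    apply is_Clim_mult; [apply is_Clim_gauss_seq|].
    apply is_Clim_plus; [apply is_Clim_const|].
    apply is_Clim_mult; [apply is_Clim_const|].
    apply is_Clim_RtoC, (is_lim_seq_incr_1 (fun n => / INR n)%R), is_lim_seq_inv_INR_S.
  - apply is_Clim_ext_loc with (fun n => z * gauss_seq (z + 1) n).
    + exists 1%nat; intros [|n] Hn; [lia|].
      unfold gauss_seq.
      pose proof (RtoC_INR_S_neq_0 n).
      pose proof (RtoC_INR_fact_neq_0 (S n)).
      pose proof (RCpower_neq_0 (INR (S n)) z).
      rewrite RCpower_plus, RCpower_1_r by (apply lt_0_INR; lia).
      rewrite RtoC_inv by (apply not_0_INR; lia).
      replace (z * (rising (z + 1) (S (S n)) / (RtoC (INR (fact (S n))) *
        (RCpower (INR (S n)) z * RtoC (INR (S n)))))) with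
        ((z * rising (z + 1) (S (S n))) / (RtoC (INR (fact (S n))) *
        (RCpower (INR (S n)) z * RtoC (INR (S n))))) by (unfold Cdiv; ring).
      rewrite <- rising_S_l.
      change (rising z (S (S (S n)))) with
        (rising z (S (S n)) * (z + RtoC (INR (S (S n))))).
      rewrite (RtoC_INR_S (S n)).
      set (r := rising z (S (S n))); field; repeat split; assumption.
    + apply is_Clim_mult; [apply is_Clim_const | apply is_Clim_gauss_seq].
Qed.

Lemma inv_Gamma_rising (z : C) (m : nat) :
  inv_Gamma z = rising z m * inv_Gamma (z + RtoC (INR m)).
Proof.
  induction m as [|m IH].
  - simpl; replace (z + 0) with z by ring; ring.
  - rewrite IH, inv_Gamma_S, RtoC_INR_S; simpl.
    replace (z + (RtoC (INR m) + 1)) with (z + RtoC (INR m) + 1) by ring; ring.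
Qed.

(** Off the poles, the iterated functional equation and the nonvanishing of [inv_Gamma] reduce the
    Gamma quotient to the polynomial used at the poles. From here on Pochhammer symbols are treated
    as polynomials. *)
Lemma pochhammer_rising (z : C) (m : nat) : pochhammer z m = rising z m.
Proof.
  destruct m as [|m]; [reflexivity|].
  unfold pochhammer; destruct (excluded_middle_informative _) as [H|H]; trivial.
  unfold CGamma.
  pose proof (inv_Gamma_neq_0 z H) as H0.
  pose proof (inv_Gamma_rising z (S m)) as E.
  assert (H1 : inv_Gamma (z + RtoC (INR (S m))) <> 0).
  { intros E1; apply H0; rewrite E, E1; ring. }
  rewrite E; set (r := rising z (S m)) in *; field; split; trivial.
  now apply rising_neq_0.
Qed.

Lemma rising_plus (z : C) (n m : nat) :
  rising z (n + m) = rising z n * rising (z + RtoC (INR n)) m.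
Proof.
  induction m as [|m IH].
  - rewrite Nat.add_0_r; simpl; ring.
  - rewrite Nat.add_succ_r; simpl; rewrite IH, plus_INR, RtoC_plus; ring.
Qed.

(** * The Beta integral *)

Lemma norm_is_RInt_increment {V : CompleteNormedModule R_AbsRing}
    (f : R -> V) (G g : R -> R) (a b p q : R) (I : V) :
  (forall t, a < t < b -> is_derive G t (g t))%R ->
  (forall t, (a < t < b)%R -> continuous g t) ->
  (forall t, (a < t < b)%R -> (norm (f t) <= g t)%R) ->
  (a < p < b)%R -> (a < q < b)%R ->
  is_RInt f p q I -> (norm I <= Rabs (G q - G p))%R.
Proof.
  intros HG Hg Hf.
  (* For ordered end points this is the integral of the majorant [g], evaluated by its primitive
     [G]; the reversed case changes only a sign. *)
  assert (W : forall p q I, (a < p < b)%R -> (a < q < b)%R -> (p <= q)%R ->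
    is_RInt f p q I -> (norm I <= Rabs (G q - G p))%R).
  { clear p q I; intros p q I Hp Hq Hpq HI.
    eapply Rle_trans; [|apply Rle_abs].
    apply (norm_RInt_le f g p q I (G q - G p)%R Hpq); trivial.
    - intros t Ht; apply Hf; lra.
    - apply (is_RInt_derive (V := R_CompleteNormedModule) G g);
        rewrite Rmin_left, Rmax_right by lra; intros t Ht; [apply HG | apply Hg]; lra. }
  intros Hp Hq HI; destruct (Rle_or_lt p q) as [L|L]; [now apply W|].
  rewrite <- norm_opp, Rabs_minus_sym.
  apply W; trivial; [lra | now apply is_RInt_swap].
Qed.

(* Cauchy criterion: by the previous bound, the integral over [[p, q]] moves by
   at most the oscillation of [G] when [p] and [q] move near the end points. *)
Lemma ex_RInt_gen_dominated {V : CompleteNormedModule R_AbsRing}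
    (f : R -> V) (G g : R -> R) (a b la lb : R) :
  (a < b)%R ->
  (forall t, (a < t < b)%R -> continuous f t) ->
  (forall t, a < t < b -> is_derive G t (g t))%R ->
  (forall t, (a < t < b)%R -> continuous g t) ->
  (forall t, (a < t < b)%R -> (norm (f t) <= g t)%R) ->
  filterlim G (at_right a) (locally la) ->
  filterlim G (at_left b) (locally lb) ->
  ex_RInt_gen f (at_right a) (at_left b).
Proof.
  intros Hab Cf HG Cg Hf La Lb.
  assert (Ra : at_right a (fun t => a < t < b)%R).
  { exists (mkposreal (b - a) ltac:(lra)); intros t Ht Hat.
    apply Rabs_def2 in Ht; unfold minus, plus, opp in Ht; simpl in Ht; lra. }
  assert (Rb : at_left b (fun t => a < t < b)%R).
  { exists (mkposreal (b - a) ltac:(lra)); intros t Ht Hat.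
    apply Rabs_def2 in Ht; unfold minus, plus, opp in Ht; simpl in Ht; lra. }
  assert (Ex : forall p q, (a < p < b)%R -> (a < q < b)%R -> ex_RInt f p q).
  { intros p q Hp Hq; apply ex_RInt_continuous; intros t Ht; apply Cf.
    revert Ht; unfold Rmin, Rmax; destruct (Rle_dec p q); lra. }
  apply (filterlimi_locally_cauchy (F := filter_prod (at_right a) (at_left b))
           (fun ab => is_RInt f (fst ab) (snd ab))).
  - eapply Filter_prod; [exact Ra | exact Rb |]; simpl; intros p q Hp Hq; split.
    + destruct (Ex p q Hp Hq) as [I HI]; now exists I.
    + intros y1 y2 H1 H2.
      now rewrite <- (is_RInt_unique _ _ _ _ H1), <- (is_RInt_unique _ _ _ _ H2).
  - intros eps.
    (* At each end, two points within eps/4 of the limit of [G] differ by less than eps/2; the two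
       ends together give eps. *)
    assert (e4 : (0 < eps / 4)%R) by (destruct eps; simpl; lra).
    pose proof (proj1 (filterlim_locally _ _) La (mkposreal _ e4)) as Ba.
    pose proof (proj1 (filterlim_locally _ _) Lb (mkposreal _ e4)) as Bb.
    exists (fun pq => ((a < fst pq < b)%R /\ ball la (eps / 4) (G (fst pq))) /\
                      ((a < snd pq < b)%R /\ ball lb (eps / 4) (G (snd pq)))).
    split.
    + eapply Filter_prod; [exact (filter_and _ _ Ra Ba) | exact (filter_and _ _ Rb Bb) |].
      simpl; tauto.
    + intros [u1 u2] [v1 v2] [[Hu1 Bu1] [Hu2 Bu2]] [[Hv1 Bv1] [Hv2 Bv2]] I J HI HJ.
      simpl in *.
      destruct (Ex v1 u1 Hv1 Hu1) as [I1 HI1].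
      destruct (Ex u2 v2 Hu2 Hv2) as [I2 HI2].
      (* The two integrals differ by the end pieces [I1] and [I2] only. *)
      assert (EJ : J = plus (plus I1 I) I2).
      { rewrite <- (is_RInt_unique _ _ _ _ HJ); apply is_RInt_unique.
        eapply is_RInt_Chasles; [|exact HI2]; eapply is_RInt_Chasles; eassumption. }
      apply (norm_compat1 (V := V) I J).
      assert (EM : minus J I = plus I1 I2).
      { rewrite EJ; unfold minus.
        rewrite (plus_comm I1 I), <- !plus_assoc, plus_comm.
        rewrite <- !plus_assoc, plus_opp_l, plus_zero_r; reflexivity. }
      change (norm (minus J I) < eps)%R; rewrite EM.
      eapply Rle_lt_trans; [apply norm_triangle|].
      pose proof (norm_is_RInt_increment f G g a b _ _ _ HG Cg Hf Hv1 Hu1 HI1) as N1.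
      pose proof (norm_is_RInt_increment f G g a b _ _ _ HG Cg Hf Hu2 Hv2 HI2) as N2.
      assert (T : (forall l x y, Rabs (x - l) < eps / 4 -> Rabs (y - l) < eps / 4 ->
                  Rabs (x - y) < eps / 2)%R).
      { intros l x y Hx Hy. apply Rabs_def2 in Hx. apply Rabs_def2 in Hy. apply Rabs_def1; lra. }
      pose proof (T la (G u1) (G v1) Bu1 Bv1).
      pose proof (T lb (G v2) (G u2) Bv2 Bu2).
      eapply Rle_lt_trans; [exact (Rplus_le_compat _ _ _ _ N1 N2) | lra].
Qed.

(** * Convergence of the Beta integral *)

Lemma exp_ln_small_at_right (a : R) (eps : posreal) :
  (0 < a)%R -> at_right 0 (fun t => exp (a * ln t) < eps)%R.
Proof.
  (* The radius is eps^(1/a). *)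
  intros Ha; exists (mkposreal (exp (ln eps / a)) (exp_pos _)); intros t Ht Ht0.
  apply Rabs_def2 in Ht; unfold minus, plus, opp in Ht; simpl in Ht.
  rewrite <- (exp_ln eps) by apply cond_pos.
  apply exp_increasing.
  assert (L : (ln t < ln eps / a)%R).
  { rewrite <- (ln_exp (ln eps / a)); apply ln_increasing; lra. }
  apply (Rmult_lt_compat_l a) in L; trivial.
  replace (a * (ln eps / a))%R with (ln eps) in L by (field; lra); exact L.
Qed.

Lemma exp_ln_small_at_left (b : R) (eps : posreal) :
  (0 < b)%R -> at_left 1 (fun t => exp (b * ln (1 - t)) < eps)%R.
Proof.
  intros Hb; destruct (exp_ln_small_at_right b eps Hb) as [d Hd].
  exists d; intros t Ht Ht1; apply Hd; [|lra].
  revert Ht; unfold ball; simpl; unfold AbsRing_ball; simpl.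
  unfold abs, minus, plus, opp; simpl.
  intros Ht; rewrite <- Rabs_Ropp; replace (- (1 - t + - 0))%R with (t + - (1))%R by ring.
  exact Ht.
Qed.

Lemma is_derive_exp_mul_ln (a t : R) :
  (0 < t)%R ->
  is_derive (fun s => exp (a * ln s)) t (a * exp ((a - 1) * ln t))%R.
Proof.
  intros Ht.
  replace (exp ((a - 1) * ln t)) with (exp (a * ln t) * / t)%R.
  - auto_derive; [assumption | field; lra].
  - rewrite <- (exp_ln (/ t)) at 1 by now apply Rinv_0_lt_compat.
    rewrite <- exp_plus, ln_Rinv by assumption; f_equal; ring.
Qed.

Lemma Cmod_beta_kernel (x y : C) (t : R) :
  Cmod (beta_kernel x y t) =
  (exp ((Re x - 1) * ln t) * exp ((Re y - 1) * ln (1 - t)))%R.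
Proof.
  unfold beta_kernel; rewrite Cmod_mult, !Cmod_RCpower.
  destruct x, y; reflexivity.
Qed.

(** On each half of the interval one of the two factors is bounded. The resulting sum of powers,
    unlike the product, has an elementary primitive. *)
Lemma beta_kernel_dominated (x y : C) :
  exists K, (0 < K)%R /\ forall t, (0 < t < 1)%R ->
    (Cmod (beta_kernel x y t)
     <= K * (exp ((Re x - 1) * ln t) + exp ((Re y - 1) * ln (1 - t))))%R.
Proof.
  set (A := exp (Rabs (Re x - 1) * ln 2)); set (B := exp (Rabs (Re y - 1) * ln 2)).
  exists (A + B)%R; split; [unfold A, B; apply Rplus_lt_0_compat; apply exp_pos|].
  intros t Ht; rewrite Cmod_beta_kernel.
  pose proof (exp_pos ((Re x - 1) * ln t)) as p1.
  pose proof (exp_pos ((Re y - 1) * ln (1 - t))) as p2.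
  assert (0 < A)%R by apply exp_pos; assert (0 < B)%R by apply exp_pos.
  destruct (Rle_or_lt t (/ 2)).
  - pose proof (exp_mul_ln_bound (Re y - 1) (1 - t) ltac:(lra)) as h; fold B in h; nra.
  - pose proof (exp_mul_ln_bound (Re x - 1) t ltac:(lra)) as h; fold A in h; nra.
Qed.

Lemma is_Cderive_continuous (f : R -> C) (t : R) (l : C) :
  is_Cderive f t l -> continuous (U := C_R_CompleteNormedModule) f t.
Proof.
  intros [H1 H2]; apply filterlim_locally; intros eps.
  pose proof (ex_derive_continuous _ _ (ex_intro _ _ H1)) as C1.
  pose proof (ex_derive_continuous _ _ (ex_intro _ _ H2)) as C2.
  pose proof (proj1 (filterlim_locally _ _) C1 eps) as B1.
  pose proof (proj1 (filterlim_locally _ _) C2 eps) as B2.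
  generalize (filter_and _ _ B1 B2); apply filter_imp; intros s [b1 b2].
  split; assumption.
Qed.

Lemma is_Cderive_continuous_components (f : R -> C) (t : R) (l : C) :
  is_Cderive f t l ->
  continuous (fun s => Re (f s)) t /\ continuous (fun s => Im (f s)) t.
Proof.
  intros [H1 H2]; split;
    [exact (ex_derive_continuous _ _ (ex_intro _ _ H1))
    |exact (ex_derive_continuous _ _ (ex_intro _ _ H2))].
Qed.

Lemma ex_is_Cderive_beta_kernel (x y : C) (t : R) :
  (0 < t < 1)%R -> exists l, is_Cderive (beta_kernel x y) t l.
Proof.
  intros Ht; eexists; apply is_Cderive_mult;
    [apply is_Cderive_RCpower | apply is_Cderive_RCpower_one_minus]; lra.
Qed.

Lemma norm_C_R (z : C) : norm (z : C_R_CompleteNormedModule) = Cmod z.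
Proof.
  change (sqrt (Rabs (fst z) ^ 2 + Rabs (snd z) ^ 2) = Cmod z).
  now rewrite !pow2_abs.
Qed.

(** With real parts in place of x and y, the majorant has primitive (K/x) t^x - (K/y) (1 - t)^y,
    which has finite limits at both ends because these real parts are positive. *)
Lemma ex_CInt01_beta_kernel (x y : C) :
  (0 < Re x)%R -> (0 < Re y)%R -> ex_CInt01 (beta_kernel x y).
Proof.
  intros Hx Hy; destruct (beta_kernel_dominated x y) as [K [HK HB]].
  set (A := fun t : R => exp (Re x * ln t)).
  set (B := fun t : R => exp (Re y * ln (1 - t))).
  assert (DA : forall t, (0 < t < 1)%R ->
    is_derive A t (Re x * exp ((Re x - 1) * ln t))%R)
    by (intros; apply is_derive_exp_mul_ln; lra).
  assert (DB : forall t, (t < 1)%R ->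
    is_derive B t (- (Re y * exp ((Re y - 1) * ln (1 - t))))%R).
  { intros t Ht; unfold B; evar_last.
    - apply (is_derive_comp (fun s => exp (Re y * ln s)) (fun t => 1 - t)%R).
      + apply is_derive_exp_mul_ln; lra.
      + evar_last; [|apply Rplus_0_l with (r := (-1)%R)]; auto_derive; trivial; ring.
    - unfold scal; simpl; unfold mult; simpl; ring. }
  (* Not by continuity: [ln] has the default value 0 at 0, so [A 0] is 1 and not the limit. The same
     holds for [B] at 1. *)
  assert (LA : filterlim A (at_right 0) (locally 0%R)).
  { apply filterlim_locally; intros eps.
    generalize (exp_ln_small_at_right (Re x) eps Hx); apply filter_imp; intros t Ht.
    change (Rabs (A t - 0) < eps)%R; rewrite Rminus_0_r, Rabs_right; trivial.
    left; apply exp_pos. }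
  assert (LB : filterlim B (at_left 1) (locally 0%R)).
  { apply filterlim_locally; intros eps.
    generalize (exp_ln_small_at_left (Re y) eps Hy); apply filter_imp; intros t Ht.
    change (Rabs (B t - 0) < eps)%R; rewrite Rminus_0_r, Rabs_right; trivial.
    left; apply exp_pos. }
  assert (LA1 : filterlim A (at_left 1) (locally (A 1))).
  { eapply filterlim_filter_le_1; [apply filter_le_within|].
    apply (ex_derive_continuous A 1%R); eexists; apply is_derive_exp_mul_ln; lra. }
  assert (LB0 : filterlim B (at_right 0) (locally (B 0%R))).
  { eapply filterlim_filter_le_1; [apply filter_le_within|].
    apply (ex_derive_continuous B 0%R); eexists; apply DB; lra. }
  assert (Lin : forall F {FF : Filter F} la lb,
    filterlim A F (locally la) -> filterlim B F (locally lb) ->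
    filterlim (fun t => plus (scal (K / Re x)%R (A t)) (scal (- (K / Re y))%R (B t))) F
      (locally (plus (scal (K / Re x)%R la) (scal (- (K / Re y))%R lb)))).
  { intros F FF la lb Ha Hb.
    eapply filterlim_comp_2; [| |apply (filterlim_plus (V := R_NormedModule))].
    - eapply filterlim_comp; [exact Ha | apply (filterlim_scal_r (V := R_NormedModule))].
    - eapply filterlim_comp; [exact Hb | apply (filterlim_scal_r (V := R_NormedModule))]. }
  eapply (ex_RInt_gen_dominated (V := C_R_CompleteNormedModule) (beta_kernel x y)
    (fun t => plus (scal (K / Re x)%R (A t)) (scal (- (K / Re y))%R (B t)))
    (fun t => K * (exp ((Re x - 1) * ln t) + exp ((Re y - 1) * ln (1 - t))))%R 0 1).
  - lra.
  - intros t Ht; destruct (ex_is_Cderive_beta_kernel x y t Ht) as [l Hl].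
    exact (is_Cderive_continuous _ _ _ Hl).
  - intros t Ht; evar_last.
    + apply (is_derive_plus (V := R_NormedModule));
        apply is_derive_scal; [apply DA | apply DB]; lra.
    + unfold plus; simpl; field; lra.
  - intros t Ht; apply (ex_derive_continuous (V := R_NormedModule)).
    auto_derive; repeat split; lra.
  - intros t Ht; rewrite norm_C_R; now apply HB.
  - apply Lin; [apply at_right_proper_filter | exact LA | exact LB0].
  - apply Lin; [apply at_left_proper_filter | exact LA1 | exact LB].
Qed.

(** * Complex linearity of the integral and the Beta recurrence *)

Lemma is_RInt_gen_Ci (f : R -> C) (Fa Fb : (R -> Prop) -> Prop)
    {FFa : Filter Fa} {FFb : Filter Fb} (l : C) :
  is_RInt_gen (V := C_R_NormedModule) f Fa Fb l ->
  is_RInt_gen (V := C_R_NormedModule) (fun t => Ci * f t) Fa Fb (Ci * l).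
Proof.
  intros H; apply filterlimi_locally; intros eps.
  pose proof (proj1 (filterlimi_locally _ _) H eps) as H1.
  revert H1; apply filter_imp; intros ab [I [HI [b1 b2]]].
  exists (Ci * I); split.
  (* Multiplication by i exchanges the components up to a sign, so each new component integral is,
     up to sign, one of the old ones. *)
  - replace (Ci * I) with ((- snd I)%R, fst I) by (destruct I; apply C_ext; simpl; ring).
    apply (is_RInt_fct_extend_pair (U := R_NormedModule) (V := R_NormedModule)).
    + apply (is_RInt_ext (V := R_NormedModule) (fun t => opp (snd (f t)))).
      * intros t _; unfold opp; simpl; ring.
      * apply (is_RInt_opp (V := R_NormedModule)).
        now apply (is_RInt_fct_extend_snd (U := R_NormedModule) (V := R_NormedModule)).
    + apply (is_RInt_ext (V := R_NormedModule) (fun t => fst (f t))).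
      * intros t _; simpl; ring.
      * now apply (is_RInt_fct_extend_fst (U := R_NormedModule) (V := R_NormedModule)).
  - change (Rabs (fst I - fst l) < eps)%R in b1.
    change (Rabs (snd I - snd l) < eps)%R in b2.
    split.
    + change (Rabs ((0 * fst I - 1 * snd I) - (0 * fst l - 1 * snd l)) < eps)%R.
      replace ((0 * fst I - 1 * snd I) - (0 * fst l - 1 * snd l))%R
        with (- (snd I - snd l))%R by ring.
      now rewrite Rabs_Ropp.
    + change (Rabs ((0 * snd I + 1 * fst I) - (0 * snd l + 1 * fst l)) < eps)%R.
      replace ((0 * snd I + 1 * fst I) - (0 * snd l + 1 * fst l))%R
        with (fst I - fst l)%R by ring.
      exact b1.
Qed.

(** The integral lives in C as a real normed space. Writing c w as Re c times w plus Im c times i w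
    reduces a complex factor to real linearity and the factor i. *)
Lemma is_RInt_gen_Cmult (f : R -> C) (Fa Fb : (R -> Prop) -> Prop)
    {FFa : Filter Fa} {FFb : Filter Fb} (c l : C) :
  is_RInt_gen (V := C_R_NormedModule) f Fa Fb l ->
  is_RInt_gen (V := C_R_NormedModule) (fun t => c * f t) Fa Fb (c * l).
Proof.
  intros H.
  assert (E : forall w : C, plus (scal (Re c) (w : C_R_NormedModule))
                                 (scal (Im c) (Ci * w : C_R_NormedModule)) = c * w).
  { intros w; destruct c, w; apply C_ext; simpl;
      unfold plus, scal; simpl; unfold mult; simpl; ring. }
  rewrite <- E.
  apply (is_RInt_gen_ext (V := C_R_NormedModule)
    (fun t => plus (scal (Re c) (f t : C_R_NormedModule))
                   (scal (Im c) (Ci * f t : C_R_NormedModule)))).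
  - eapply Filter_prod; [apply filter_true | apply filter_true |].
    intros p q _ _ t _; apply E.
  - apply (is_RInt_gen_plus (V := C_R_NormedModule));
      apply (is_RInt_gen_scal (V := C_R_NormedModule)); trivial.
    now apply is_RInt_gen_Ci.
Qed.

Lemma at_right_0_lt_1 : at_right 0 (fun t => 0 < t < 1)%R.
Proof.
  exists (mkposreal 1 Rlt_0_1); intros t Ht Hat.
  apply Rabs_def2 in Ht; unfold minus, plus, opp in Ht; simpl in Ht; lra.
Qed.

Lemma at_left_1_gt_0 : at_left 1 (fun t => 0 < t < 1)%R.
Proof.
  exists (mkposreal 1 Rlt_0_1); intros t Ht Hat.
  apply Rabs_def2 in Ht; unfold minus, plus, opp in Ht; simpl in Ht; lra.
Qed.

(** The integral over [p, q] is [F q - F p], which is small near the ends. Differentiability of [d]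
    supplies the continuity that the fundamental theorem of calculus asks for. *)
Lemma is_RInt_gen_Cderive_vanishing (F d : R -> C) :
  (forall t, (0 < t < 1)%R -> is_Cderive F t (d t)) ->
  (forall t, (0 < t < 1)%R -> exists l, is_Cderive d t l) ->
  (forall eps : posreal, at_right 0 (fun t => Cmod (F t) < eps)%R) ->
  (forall eps : posreal, at_left 1 (fun t => Cmod (F t) < eps)%R) ->
  is_RInt_gen (V := C_R_NormedModule) d (at_right 0) (at_left 1) (RtoC 0).
Proof.
  intros HF Hd H0 H1; apply filterlimi_locally; intros eps.
  assert (e2 : (0 < eps / 2)%R) by (destruct eps; simpl; lra).
  eapply Filter_prod;
    [ exact (filter_and _ _ at_right_0_lt_1 (H0 (mkposreal _ e2)))
    | exact (filter_and _ _ at_left_1_gt_0 (H1 (mkposreal _ e2))) |].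
  simpl; intros p q [Hp Fp] [Hq Fq].
  exists (F q - F p).
  assert (Hpq : forall t, (Rmin p q <= t <= Rmax p q)%R -> (0 < t < 1)%R)
    by (intros t; unfold Rmin, Rmax; destruct (Rle_dec p q); lra).
  split.
  - apply (is_RInt_fct_extend_pair (U := R_NormedModule) (V := R_NormedModule));
      [ apply (is_RInt_derive (V := R_CompleteNormedModule) (fun t => Re (F t)))
      | apply (is_RInt_derive (V := R_CompleteNormedModule) (fun t => Im (F t))) ];
      intros t Ht; try apply (HF t (Hpq t Ht));
      destruct (Hd t (Hpq t Ht)) as [l Hl];
      apply (is_Cderive_continuous_components _ _ _ Hl).
  - assert (B : (Cmod (F q - F p) < eps)%R).
    { eapply Rle_lt_trans; [apply Cmod_triangle|]; rewrite Cmod_opp; lra. }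
    split.
    + change (Rabs (Re (F q - F p) - 0) < eps)%R; rewrite Rminus_0_r.
      eapply Rle_lt_trans; [apply re_le_Cmod | exact B].
    + change (Rabs (Im (F q - F p) - 0) < eps)%R; rewrite Rminus_0_r.
      eapply Rle_lt_trans; [apply Rabs_Im_le_Cmod | exact B].
Qed.

Lemma is_Cderive_Cmult_l (f : R -> C) (t : R) (c l : C) :
  is_Cderive f t l -> is_Cderive (fun s => c * f s) t (c * l).
Proof.
  intros H; replace (c * l) with (0 * f t + c * l) by ring.
  apply (is_Cderive_mult (fun _ => c)); trivial.
  split; apply (is_derive_const (V := R_NormedModule)).
Qed.

Lemma is_Cderive_minus (f g : R -> C) (t : R) (l m : C) :
  is_Cderive f t l -> is_Cderive g t m -> is_Cderive (fun s => f s - g s) t (l - m).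
Proof.
  intros [f1 f2] [g1 g2]; split.
  - now apply (is_derive_minus (V := R_NormedModule) (fun s => Re (f s))).
  - now apply (is_derive_minus (V := R_NormedModule) (fun s => Im (f s))).
Qed.

(* Integrate the derivative of [t^x (1 - t)^y], which vanishes at both ends. *)
Lemma CBeta_S_l (x y : C) :
  (0 < Re x)%R -> (0 < Re y)%R -> (x + y) * CBeta (x + 1) y = x * CBeta x y.
Proof.
  intros Hx Hy.
  assert (HI : forall u, (0 < Re u)%R ->
    is_RInt_gen (V := C_R_NormedModule) (beta_kernel u y) (at_right 0) (at_left 1)
      (CBeta u y)).
  { intros u Hu; unfold CBeta, CInt01.
    apply (RInt_gen_correct (V := C_R_CompleteNormedModule)).
    now apply ex_CInt01_beta_kernel. }
  pose proof (HI x Hx) as I0.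
  assert (Hx1 : (0 < Re (x + 1))%R).
  { change (0 < Re x + 1)%R. lra. }
  pose proof (HI (x + 1) Hx1) as I1.
  (* The derivative of t^x (1 - t)^y is x (1 - t) - y t = x - (x + y) t times the kernel, and a
     factor t raises [x] by one. *)
  set (d := fun t => x * beta_kernel x y t - (x + y) * beta_kernel (x + 1) y t).
  assert (J : is_RInt_gen (V := C_R_NormedModule) d (at_right 0) (at_left 1)
                (x * CBeta x y - (x + y) * CBeta (x + 1) y)).
  { exact (is_RInt_gen_minus (V := C_R_NormedModule) _ _ _ _
             (is_RInt_gen_Cmult _ _ _ x _ I0) (is_RInt_gen_Cmult _ _ _ (x + y) _ I1)). }
  assert (J0 : is_RInt_gen (V := C_R_NormedModule) d (at_right 0) (at_left 1) (RtoC 0)).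
  { apply is_RInt_gen_Cderive_vanishing with
      (F := fun t => RCpower t x * RCpower (1 - t) y).
    - intros t Ht.
      pose proof (is_Cderive_mult _ _ _ _ _
        (is_Cderive_RCpower x t (proj1 Ht))
        (is_Cderive_RCpower_one_minus y t (proj2 Ht))) as D.
      replace (d t) with
        (x * RCpower t (x - 1) * RCpower (1 - t) y +
         RCpower t x * - (y * RCpower (1 - t) (y - 1))); [exact D|].
      unfold d, beta_kernel.
      replace (x + 1 - 1) with x by ring.
      replace (RCpower t x) with (RCpower t (x - 1) * RtoC t).
      + replace (RCpower (1 - t) y) with (RCpower (1 - t) (y - 1) * RtoC (1 - t)).
        * rewrite RtoC_minus; ring.
        * rewrite <- (RCpower_1_r (1 - t)) by lra.
          rewrite <- RCpower_plus; f_equal; ring.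
      + rewrite <- (RCpower_1_r t) by lra.
        rewrite <- RCpower_plus; f_equal; ring.
    - intros t Ht.
      destruct (ex_is_Cderive_beta_kernel x y t Ht) as [l Hl].
      destruct (ex_is_Cderive_beta_kernel (x + 1) y t Ht) as [m Hm].
      eexists; apply is_Cderive_minus; apply is_Cderive_Cmult_l; eassumption.
    - intros eps.
      generalize (filter_and _ _ at_right_0_lt_1 (exp_ln_small_at_right (Re x) eps Hx)).
      apply filter_imp; intros t [Ht He].
      rewrite Cmod_mult, !Cmod_RCpower.
      pose proof (exp_mul_ln_le_1 (Re y) (1 - t) ltac:(lra) ltac:(lra)).
      pose proof (exp_pos (Re x * ln t)); eapply Rle_lt_trans; [|exact He]; nra.
    - intros eps.
      generalize (filter_and _ _ at_left_1_gt_0 (exp_ln_small_at_left (Re y) eps Hy)).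
      apply filter_imp; intros t [Ht He].
      rewrite Cmod_mult, !Cmod_RCpower.
      pose proof (exp_mul_ln_le_1 (Re x) t ltac:(lra) ltac:(lra)).
      pose proof (exp_pos (Re y * ln (1 - t))); eapply Rle_lt_trans; [|exact He]; nra. }
  pose proof (is_RInt_gen_unique (V := C_R_CompleteNormedModule) _ _ J) as U.
  rewrite (is_RInt_gen_unique (V := C_R_CompleteNormedModule) _ _ J0) in U.
  symmetry; now apply Ceq_minus.
Qed.

Lemma CBeta_rising (x y : C) (n : nat) :
  (0 < Re x)%R -> (0 < Re y)%R ->
  rising (x + y) n * CBeta (x + RtoC (INR n)) y = rising x n * CBeta x y.
Proof.
  intros Hx Hy; induction n as [|n IH].
  - simpl; now replace (x + 0) with x by ring.
  - rewrite RtoC_INR_S; simpl.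
    assert (Hn : (0 < Re (x + RtoC (INR n)))%R)
      by (pose proof (pos_INR n); destruct x; simpl in *; lra).
    pose proof (CBeta_S_l (x + RtoC (INR n)) y Hn Hy) as E.
    replace (x + (RtoC (INR n) + 1)) with (x + RtoC (INR n) + 1) by ring.
    replace (rising (x + y) n * (x + y + RtoC (INR n)) * CBeta (x + RtoC (INR n) + 1) y)
      with (rising (x + y) n *
            ((x + RtoC (INR n) + y) * CBeta (x + RtoC (INR n) + 1) y)) by ring.
    rewrite E.
    replace (rising (x + y) n * ((x + RtoC (INR n)) * CBeta (x + RtoC (INR n)) y))
      with ((rising (x + y) n * CBeta (x + RtoC (INR n)) y) * (x + RtoC (INR n))) by ring.
    rewrite IH; ring.
Qed.

(** * Complex power series *)

Lemma sum_n_Re (a : nat -> C) (n : nat) :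
  Re (sum_n (G := C_NormedModule) a n) = sum_n (fun k => Re (a k)) n.
Proof.
  induction n as [|n IH].
  - now rewrite !sum_O.
  - rewrite !sum_Sn, <- IH; reflexivity.
Qed.

Lemma sum_n_Im (a : nat -> C) (n : nat) :
  Im (sum_n (G := C_NormedModule) a n) = sum_n (fun k => Im (a k)) n.
Proof.
  induction n as [|n IH].
  - now rewrite !sum_O.
  - rewrite !sum_Sn, <- IH; reflexivity.
Qed.

(** Links convergence in the normed space C, as in [MGauss_defined], with the componentwise sum
    [CSeries]. *)
Lemma is_series_C (a : nat -> C) (l : C) :
  is_series (V := C_NormedModule) a l <->
  is_series (fun k => Re (a k)) (Re l) /\ is_series (fun k => Im (a k)) (Im l).
Proof.
  split.
  - intros H; split; apply filterlim_locally; intros eps;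
      generalize (proj1 (filterlim_locally _ _) H eps); apply filter_imp;
      intros n [b1 b2].
    + rewrite <- sum_n_Re; exact b1.
    + rewrite <- sum_n_Im; exact b2.
  - intros [H1 H2]; apply filterlim_locally; intros eps.
    pose proof (proj1 (filterlim_locally _ _) H1 eps) as B1.
    pose proof (proj1 (filterlim_locally _ _) H2 eps) as B2.
    generalize (filter_and _ _ B1 B2); apply filter_imp; intros n [b1 b2].
    rewrite <- sum_n_Re in b1; rewrite <- sum_n_Im in b2; split; assumption.
Qed.

Lemma CSeries_unique (a : nat -> C) (l : C) :
  is_series (V := C_NormedModule) a l -> CSeries a = l.
Proof.
  intros [H1 H2]%is_series_C; unfold CSeries.
  rewrite (is_series_unique _ _ H1), (is_series_unique _ _ H2); now destruct l.
Qed.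

Lemma CSeries_correct (a : nat -> C) :
  ex_series (V := C_NormedModule) a -> is_series (V := C_NormedModule) a (CSeries a).
Proof. intros [l H]; now rewrite (CSeries_unique a l H). Qed.

Lemma CSeries_ext (a b : nat -> C) :
  (forall k, a k = b k) -> CSeries a = CSeries b.
Proof.
  intros H; unfold CSeries; f_equal; apply Series_ext; intros k; now rewrite H.
Qed.

Lemma ex_series_C_dominated (a : nat -> C) (b : nat -> R) :
  (forall k, Cmod (a k) <= b k)%R -> ex_series b -> ex_series (V := C_NormedModule) a.
Proof.
  intros H Hb.
  destruct (ex_series_le (K := R_AbsRing) (V := R_CompleteNormedModule)
              (fun k => Re (a k)) b) as [l1 H1]; trivial.
  { intros k; eapply Rle_trans; [apply re_le_Cmod | apply H]. }
  destruct (ex_series_le (K := R_AbsRing) (V := R_CompleteNormedModule)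
              (fun k => Im (a k)) b) as [l2 H2]; trivial.
  { intros k; eapply Rle_trans; [apply Rabs_Im_le_Cmod | apply H]. }
  exists (l1, l2); now apply is_series_C.
Qed.

Lemma Cmod_is_series_dominated (a : nat -> C) (b : nat -> R) (l : C) :
  (forall k, Cmod (a k) <= b k)%R -> ex_series b ->
  is_series (V := C_NormedModule) a l -> (Cmod l <= 2 * Series b)%R.
Proof.
  intros H Hb [H1 H2]%is_series_C.
  assert (B : forall u l, (forall k, Rabs (u k) <= b k)%R -> is_series u l ->
            (Rabs l <= Series b)%R).
  { intros u x Hu Hx; rewrite <- (is_series_unique u x Hx).
    eapply Rle_trans; [apply Series_Rabs | apply Series_le]; trivial.
    - apply (ex_series_le (K := R_AbsRing) (V := R_CompleteNormedModule)) with b; trivial.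
      intros k; change (Rabs (Rabs (u k)) <= b k)%R; now rewrite Rabs_Rabsolu.
    - intros k; split; [apply Rabs_pos | apply Hu]. }
  eapply Rle_trans; [apply Cmod_le_Rabs|].
  pose proof (B _ _ (fun k => Rle_trans _ _ _ (re_le_Cmod (a k)) (H k)) H1).
  pose proof (B _ _ (fun k => Rle_trans _ _ _ (Rabs_Im_le_Cmod (a k)) (H k)) H2).
  lra.
Qed.

(** Plays the role of a radius of convergence of at least [r]. The strict bound on [s] leaves room
    to multiply coefficients by [k] with the same [r]. *)
Definition abs_summable_below (a : nat -> C) (r : R) : Prop :=
  forall s, (0 < s < r)%R -> ex_series (fun k => Cmod (a k) * s ^ k)%R.

(** Abel's lemma: the terms of a convergent series are bounded, so at radius [s] they are dominated
    by a geometric series of ratio s/|w|. *)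
Lemma abs_summable_below_of_ex_series (a : nat -> C) (w : C) :
  ex_series (V := C_NormedModule) (fun k => a k * w ^ k) ->
  abs_summable_below a (Cmod w).
Proof.
  intros [l [H1 H2]%is_series_C] s Hs.
  destruct (filterlim_bounded (fun k => Re (a k * w ^ k))) as [M1 B1].
  { exists 0%R; apply ex_series_lim_0; eexists; exact H1. }
  destruct (filterlim_bounded (fun k => Im (a k * w ^ k))) as [M2 B2].
  { exists 0%R; apply ex_series_lim_0; eexists; exact H2. }
  set (q := (s / Cmod w)%R).
  assert (Hq : (0 < q < 1)%R).
  { unfold q; split; [apply Rdiv_lt_0_compat; lra|].
    apply (Rmult_lt_reg_r (Cmod w)); [lra|]; field_simplify; lra. }
  apply (ex_series_le (K := R_AbsRing) (V := R_CompleteNormedModule)) with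
    (fun k => (M1 + M2) * q ^ k)%R.
  - intros k.
    change (Rabs (Cmod (a k) * s ^ k) <= (M1 + M2) * q ^ k)%R.
    assert (Hqk : (0 < q ^ k)%R) by (apply pow_lt; lra).
    replace (s ^ k)%R with (Cmod w ^ k * q ^ k)%R.
    + rewrite <- Rmult_assoc, <- Cmod_pow, <- Cmod_mult, Rabs_right.
      * apply Rmult_le_compat_r; [lra|].
        eapply Rle_trans; [apply Cmod_le_Rabs|].
        apply Rplus_le_compat; [apply B1 | apply B2].
      * apply Rle_ge, Rmult_le_pos; [apply Cmod_ge_0 | lra].
    + rewrite <- Rpow_mult_distr; f_equal; unfold q; field; lra.
  - apply (ex_series_scal (M1 + M2)%R (fun k => q ^ k)%R), ex_series_geom.
    rewrite Rabs_right; lra.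
Qed.

Lemma abs_summable_below_S (a : nat -> C) (r : R) :
  abs_summable_below a r -> abs_summable_below (fun k => a (S k)) r.
Proof.
  intros H s Hs.
  pose proof (proj1 (ex_series_incr_1 _) (H s Hs)) as H1.
  apply (ex_series_ext (fun k => / s * (Cmod (a (S k)) * s ^ S k))%R).
  - intros k; simpl; field; lra.
  - now apply (ex_series_scal (/ s)%R (fun k => Cmod (a (S k)) * s ^ S k)%R).
Qed.

(* [k s^k <= t^k / h] when [t = s (1 + h)], by Bernoulli's inequality. *)
Lemma abs_summable_below_INR (a : nat -> C) (r : R) :
  abs_summable_below a r -> abs_summable_below (fun k => RtoC (INR k) * a k) r.
Proof.
  intros H s Hs.
  set (t := ((s + r) / 2)%R); set (h := (t / s - 1)%R).
  assert (Ht : (s < t < r)%R) by (unfold t; lra).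
  assert (Et : (t = s * (1 + h))%R) by (unfold h; field; lra).
  assert (Hh : (0 < h)%R) by nra.
  apply (ex_series_le (K := R_AbsRing) (V := R_CompleteNormedModule)) with
    (fun k => / h * (Cmod (a k) * t ^ k))%R.
  - intros k; rewrite Cmod_mult, Cmod_R.
    change (Rabs (Rabs (INR k) * Cmod (a k) * s ^ k) <= / h * (Cmod (a k) * t ^ k))%R.
    pose proof (pos_INR k) as Hk; pose proof (Cmod_ge_0 (a k)) as Ha.
    assert (Hsk : (0 < s ^ k)%R) by (apply pow_lt; lra).
    rewrite (Rabs_right (INR k)), Rabs_right by
      (apply Rle_ge; repeat apply Rmult_le_pos; lra).
    rewrite Et, Rpow_mult_distr.
    assert (B : (INR k <= / h * (1 + h) ^ k)%R).
    { apply (Rmult_le_reg_l h); trivial.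
      rewrite <- Rmult_assoc, Rinv_r, Rmult_1_l by lra.
      pose proof (poly k h Hh); lra. }
    replace (INR k * Cmod (a k) * s ^ k)%R with ((Cmod (a k) * s ^ k) * INR k)%R by ring.
    replace (/ h * (Cmod (a k) * (s ^ k * (1 + h) ^ k)))%R with
      ((Cmod (a k) * s ^ k) * (/ h * (1 + h) ^ k))%R by ring.
    apply Rmult_le_compat_l; trivial; apply Rmult_le_pos; lra.
  - apply (ex_series_scal (/ h)%R (fun k => Cmod (a k) * t ^ k)%R), H; lra.
Qed.

Definition derive_coeff (a : nat -> C) (k : nat) : C := RtoC (INR (S k)) * a (S k).

Definition Cpower_series (a : nat -> C) (w : C) : C := CSeries (fun k => a k * w ^ k).

Lemma abs_summable_below_derive_coeff (a : nat -> C) (r : R) :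
  abs_summable_below a r -> abs_summable_below (derive_coeff a) r.
Proof. intros H; exact (abs_summable_below_S _ _ (abs_summable_below_INR a r H)). Qed.

Lemma abs_summable_below_iter_derive_coeff (a : nat -> C) (r : R) (n : nat) :
  abs_summable_below a r -> abs_summable_below (Nat.iter n derive_coeff a) r.
Proof.
  intros H; induction n as [|n IH]; trivial.
  now apply abs_summable_below_derive_coeff.
Qed.

(** * Termwise differentiation of power series *)

Lemma is_series_Cpower_series (a : nat -> C) (r : R) (w : C) :
  abs_summable_below a r -> (Cmod w < r)%R ->
  is_series (V := C_NormedModule) (fun k => a k * w ^ k) (Cpower_series a w).
Proof.
  intros H Hw; apply CSeries_correct.
  pose proof (Cmod_ge_0 w).
  apply ex_series_C_dominated with (2 := H ((Cmod w + r) / 2)%R ltac:(lra)).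
  intros k; rewrite Cmod_mult, Cmod_pow.
  apply Rmult_le_compat_l; [apply Cmod_ge_0|].
  apply pow_incr; lra.
Qed.

(** Induction on v^(k+1) - w^(k+1) = v (v^k - w^k) + (v - w) w^k. The factor [s] on the left
    replaces an exponent k - 1 on the right, which would be awkward at k = 0. *)
Lemma Cmod_pow_minus_le (v w : C) (s : R) (k : nat) :
  (Cmod v <= s)%R -> (Cmod w <= s)%R ->
  (Cmod (v ^ k - w ^ k) * s <= Cmod (v - w) * INR k * s ^ k)%R.
Proof.
  intros Hv Hw; pose proof (Cmod_ge_0 v); pose proof (Cmod_ge_0 w).
  induction k as [|k IH].
  - replace (v ^ 0 - w ^ 0) with (RtoC 0) by (simpl; ring).
    rewrite Cmod_0; simpl; lra.
  - replace (v ^ S k - w ^ S k) with (v * (v ^ k - w ^ k) + (v - w) * w ^ k)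
      by (simpl; ring).
    assert (T : (Cmod (v * (v ^ k - w ^ k) + (v - w) * w ^ k)
                 <= s * Cmod (v ^ k - w ^ k) + Cmod (v - w) * s ^ k)%R).
    { eapply Rle_trans; [apply Cmod_triangle|]; rewrite !Cmod_mult, Cmod_pow.
      apply Rplus_le_compat.
      - apply Rmult_le_compat_r; [apply Cmod_ge_0 | assumption].
      - apply Rmult_le_compat_l; [apply Cmod_ge_0 | apply pow_incr; lra]. }
    rewrite S_INR; simpl pow; nra.
Qed.

(* The remainders [E k] satisfy [E (k + 1) = w E k + (v - w) (v^k - w^k)]. *)
Lemma Cmod_pow_taylor_le (v w : C) (s : R) (k : nat) :
  (Cmod v <= s)%R -> (Cmod w <= s)%R ->
  (Cmod (v ^ k - w ^ k - (v - w) * (RtoC (INR k) * w ^ pred k)) * s ^ 2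
   <= Cmod (v - w) ^ 2 * INR k ^ 2 * s ^ k)%R.
Proof.
  intros Hv Hw; pose proof (Cmod_ge_0 v); pose proof (Cmod_ge_0 w).
  induction k as [|k IH].
  - replace (v ^ 0 - w ^ 0 - (v - w) * (RtoC (INR 0) * w ^ pred 0)) with (RtoC 0)
      by (simpl; ring).
    rewrite Cmod_0; simpl; lra.
  (* At k = 0 the exponent [pred 0] is 0, but the factor [INR k] makes both sides vanish. *)
  - assert (Ek : RtoC (INR k) * w ^ k = w * (RtoC (INR k) * w ^ pred k)).
    { destruct k; simpl; ring. }
    set (E := v ^ k - w ^ k - (v - w) * (RtoC (INR k) * w ^ pred k)) in *.
    replace (v ^ S k - w ^ S k - (v - w) * (RtoC (INR (S k)) * w ^ pred (S k)))
      with (w * E + (v - w) * (v ^ k - w ^ k)).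
    + assert (T : (Cmod (w * E + (v - w) * (v ^ k - w ^ k))
                   <= s * Cmod E + Cmod (v - w) * Cmod (v ^ k - w ^ k))%R).
      { eapply Rle_trans; [apply Cmod_triangle|]; rewrite !Cmod_mult.
        apply Rplus_le_compat_r, Rmult_le_compat_r; [apply Cmod_ge_0 | assumption]. }
      pose proof (Cmod_pow_minus_le v w s k Hv Hw) as P.
      pose proof (Cmod_ge_0 (v - w)) as D.
      pose proof (pos_INR k) as Hk.
      assert (Hsk : (0 <= s ^ k)%R) by (apply pow_le; lra).
      set (e := Cmod E) in *; set (p := Cmod (v ^ k - w ^ k)) in *.
      set (dd := Cmod (v - w)) in *; set (x := INR k) in *; set (S0 := (s ^ k)%R) in *.
      rewrite S_INR; fold x; simpl pow in *; fold S0.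
      apply Rle_trans with ((s * e + dd * p) * (s * (s * 1)))%R.
      { apply Rmult_le_compat_r; trivial; nra. }
      (* [A1] contributes k^2 and [A2] contributes k; [A3] is the slack k + 1 between k^2 + k and (k
         + 1)^2. *)
      assert (A1 : (s * (e * (s * (s * 1))) <= s * (dd * (dd * 1) * (x * (x * 1)) * S0))%R)
        by (apply Rmult_le_compat_l; lra).
      assert (A2 : (dd * s * (p * s) <= dd * s * (dd * x * S0))%R)
        by (apply Rmult_le_compat_l; trivial; nra).
      assert (A3 : (0 <= dd * dd * (x + 1) * (s * S0))%R)
        by (repeat apply Rmult_le_pos; lra).
      nra.
    + rewrite RtoC_INR_S; simpl pred.
      replace ((v - w) * ((RtoC (INR k) + 1) * w ^ k)) with
        ((v - w) * (RtoC (INR k) * w ^ k + w ^ k)) by ring.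
      rewrite Ek; unfold E; simpl; ring.
Qed.

(** The termwise Taylor remainders are summed. Their weights k^2 |a_k| s^k are summable by two uses
    of [abs_summable_below_INR], and the 2 in the constant comes from [Cmod_is_series_dominated]. *)
Lemma Cpower_series_taylor_le (a : nat -> C) (r s : R) :
  abs_summable_below a r -> (0 < s < r)%R ->
  exists K, (0 <= K)%R /\ forall v w, (Cmod v <= s)%R -> (Cmod w <= s)%R ->
    (Cmod (Cpower_series a v - Cpower_series a w
           - (v - w) * Cpower_series (derive_coeff a) w) <= K * Cmod (v - w) ^ 2)%R.
Proof.
  intros H Hs.
  set (b := fun k : nat => (Cmod (RtoC (INR k) * (RtoC (INR k) * a k)) * s ^ k)%R).
  assert (Hb : ex_series b) by (apply abs_summable_below_INR with (r := r); trivial;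
    now apply abs_summable_below_INR).
  assert (Hb0 : (0 <= Series b)%R).
  { eapply Rle_trans; [apply Rabs_pos|].
    apply (Rle_trans _ _ _ (Series_Rabs b ltac:(apply (ex_series_ext b); trivial;
      intros k; symmetry; apply Rabs_right, Rle_ge, Rmult_le_pos;
      [apply Cmod_ge_0 | apply pow_le; lra]))).
    right; apply Series_ext; intros k; apply Rabs_right, Rle_ge, Rmult_le_pos;
      [apply Cmod_ge_0 | apply pow_le; lra]. }
  exists (2 * (Series b / s ^ 2))%R; split.
  { assert (0 < s ^ 2)%R by (apply pow_lt; lra).
    apply Rmult_le_pos; [lra|]; apply Rdiv_le_0_compat; lra. }
  intros v w Hv Hw.
  assert (Sv := is_series_Cpower_series a r v H ltac:(lra)).
  assert (Sw := is_series_Cpower_series a r w H ltac:(lra)).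
  (* The derivative series is shifted to start with a zero term, which aligns it index by index with
     the other two. *)
  assert (Sd : is_series (V := C_NormedModule)
                 (fun k => RtoC (INR k) * a k * w ^ pred k)
                 (Cpower_series (derive_coeff a) w)).
  { apply is_series_decr_1.
    replace (plus _ _) with (Cpower_series (derive_coeff a) w).
    - apply (is_series_Cpower_series _ r); [now apply abs_summable_below_derive_coeff | lra].
    - change (Cpower_series (derive_coeff a) w =
        Cpower_series (derive_coeff a) w + - (RtoC (INR 0) * a 0%nat * w ^ pred 0)).
      simpl; ring. }
  pose proof (is_series_minus _ _ _ _ (is_series_minus _ _ _ _ Sv Sw)
                (is_series_scal (v - w) _ _ Sd)) as SE.
  replace (2 * (Series b / s ^ 2) * Cmod (v - w) ^ 2)%R with
    (2 * Series (fun k => Cmod (v - w) ^ 2 / s ^ 2 * b k))%R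
    by (rewrite Series_scal_l; field; lra).
  apply Cmod_is_series_dominated with (3 := SE).
  - intros k.
    pose proof (Cmod_pow_taylor_le v w s k Hv Hw) as T.
    assert (s2 : (0 < s ^ 2)%R) by (apply pow_lt; lra).
    match goal with |- (Cmod ?X <= _)%R => replace X with
      (a k * (v ^ k - w ^ k - (v - w) * (RtoC (INR k) * w ^ pred k))) end.
    + rewrite Cmod_mult; unfold b; rewrite !Cmod_mult, Cmod_R, Rabs_right
        by (apply Rle_ge, pos_INR).
      apply (Rmult_le_reg_r (s ^ 2)); trivial.
      replace (Cmod (v - w) ^ 2 / s ^ 2 * (INR k * (INR k * Cmod (a k)) * s ^ k) * s ^ 2)%R
        with (Cmod (a k) * (Cmod (v - w) ^ 2 * INR k ^ 2 * s ^ k))%R by (field; lra).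
      rewrite Rmult_assoc; apply Rmult_le_compat_l; [apply Cmod_ge_0 | exact T].
    + unfold minus, plus, opp, scal; simpl; unfold mult; simpl; ring.
  - now apply (ex_series_scal (Cmod (v - w) ^ 2 / s ^ 2)%R b).
Qed.

Lemma locally_C_Cmod (z : C) (P : C -> Prop) (d : R) :
  (0 < d)%R -> (forall w, (Cmod (w - z) < d)%R -> P w) ->
  locally (T := C_UniformSpace) z P.
Proof.
  intros Hd H; apply locally_C; exists (mkposreal d Hd); intros w Hw; apply H, Hw.
Qed.

Lemma is_derive_Cpower_series (a : nat -> C) (r : R) (w : C) :
  abs_summable_below a r -> (Cmod w < r)%R ->
  is_derive (K := C_AbsRing) (V := C_NormedModule) (Cpower_series a) w
    (Cpower_series (derive_coeff a) w).
Proof.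
  intros H Hw.
  set (s := ((Cmod w + r) / 2)%R).
  pose proof (Cmod_ge_0 w) as Hw0.
  destruct (Cpower_series_taylor_le a r s H ltac:(unfold s; lra)) as [K [HK T]].
  split; [apply is_linear_scal_l|].
  intros x Hx.
  apply (is_filter_lim_locally_unique (V := AbsRing_NormedModule C_AbsRing)) in Hx; subst x.
  intros eps.
  (* The first bound keeps [v] in the disc of radius [s], the second makes K |v - w| less than eps;
     K + 1 avoids division by zero. *)
  assert (Hd : (0 < Rmin (s - Cmod w) (eps / (K + 1)))%R).
  { apply Rmin_pos; [unfold s; lra|].
    apply Rdiv_lt_0_compat; [apply cond_pos | lra]. }
  exists (mkposreal _ Hd); intros v Hv.
  change (Cmod (v - w) < Rmin (s - Cmod w) (eps / (K + 1)))%R in Hv.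
  assert (H1 : (Cmod (v - w) < s - Cmod w)%R) by (eapply Rlt_le_trans; [exact Hv|apply Rmin_l]).
  assert (H2 : (Cmod (v - w) < eps / (K + 1))%R) by (eapply Rlt_le_trans; [exact Hv|apply Rmin_r]).
  change (Cmod (Cpower_series a v - Cpower_series a w
           - (v - w) * Cpower_series (derive_coeff a) w) <= eps * Cmod (v - w))%R.
  eapply Rle_trans; [apply T|].
  - replace v with (w + (v - w)) by ring.
    eapply Rle_trans; [apply Cmod_triangle|]; lra.
  - unfold s; lra.
  - pose proof (Cmod_ge_0 (v - w)) as D.
    assert (H3 : (Cmod (v - w) * (K + 1) < eps)%R).
    { apply (Rmult_lt_compat_r (K + 1)) in H2; [|lra].
      replace (eps / (K + 1) * (K + 1))%R with (pos eps) in H2 by (field; lra); exact H2. }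
    simpl pow; nra.
Qed.

(** The induction is over all points of the disc at once, because [is_C_derive_n] requires the lower
    derivatives on a neighbourhood. *)
Lemma is_C_derive_n_Cpower_series (a : nat -> C) (r : R) (n : nat) (w : C) :
  abs_summable_below a r -> (Cmod w < r)%R ->
  is_C_derive_n (Cpower_series a) n w (Cpower_series (Nat.iter n derive_coeff a) w).
Proof.
  intros H; revert w; induction n as [|n IH]; intros w Hw; [reflexivity|].
  exists (Cpower_series (Nat.iter n derive_coeff a)); split.
  - apply locally_C_Cmod with (r - Cmod w)%R; [lra|].
    intros v Hv; apply IH.
    replace v with (w + (v - w)) by ring.
    eapply Rle_lt_trans; [apply Cmod_triangle|]; lra.
  - apply is_derive_Cpower_series with r; trivial.
    now apply abs_summable_below_iter_derive_coeff.
Qed.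

Lemma is_C_derive_n_ext (f g : C -> C) (n : nat) (z l : C) :
  (forall w, f w = g w) -> is_C_derive_n f n z l -> is_C_derive_n g n z l.
Proof.
  intros E; revert z l; induction n as [|n IH]; intros z l.
  - simpl; now rewrite E.
  - intros [h [H1 H2]]; exists h; split; trivial.
    revert H1; apply filter_imp; intros w; apply IH.
Qed.

Lemma iter_derive_coeff (a : nat -> C) (n k : nat) :
  Nat.iter n derive_coeff a k =
  RtoC (INR (fact (k + n))) / RtoC (INR (fact k)) * a (k + n)%nat.
Proof.
  revert k; induction n as [|n IH]; intros k.
  - rewrite Nat.add_0_r; simpl; pose proof (RtoC_INR_fact_neq_0 k); field; assumption.
  - change (Nat.iter (S n) derive_coeff a k) with
      (RtoC (INR (S k)) * Nat.iter n derive_coeff a (S k)).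
    rewrite IH, Nat.add_succ_r, Nat.add_succ_l.
    rewrite (fact_simpl k), mult_INR, RtoC_mult.
    pose proof (RtoC_INR_fact_neq_0 k); pose proof (RtoC_INR_S_neq_0 k).
    set (x := RtoC (INR (fact (S (k + n))))); field; tauto.
Qed.

Lemma locally_C_farther_point (z : C) (P : C -> Prop) :
  locally (T := C_UniformSpace) z P -> exists w, (Cmod z < Cmod w)%R /\ P w.
Proof.
  intros [[e He] H].
  (* Moving the real part away from 0, by half the radius of the neighbourhood, increases the
     modulus. The choice of 1 at [Re z = 0] covers z = 0. *)
  set (sg := if Rle_dec 0 (Re z) then 1%R else (-1)%R).
  assert (Hsg : sg = 1%R /\ (0 <= Re z)%R \/ sg = (-1)%R /\ (Re z < 0)%R)
    by (unfold sg; destruct (Rle_dec 0 (Re z)); [left | right]; split; trivial; lra).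
  exists (Re z + sg * (e / 2), Im z)%R; split.
  - apply sqrt_lt_1_alt; simpl fst; simpl snd; unfold Re, Im in *; split; nra.
  - apply H; split; simpl.
    + change (Rabs (Re z + sg * (e / 2) - Re z) < e)%R.
      apply Rabs_def1; destruct Hsg as [[-> _]|[-> _]]; lra.
    + change (Rabs (Im z - Im z) < e)%R.
      rewrite Rminus_diag, Rabs_R0; exact He.
Qed.

Lemma Cinv_0 : / RtoC 0 = 0.
Proof. apply C_ext; simpl; unfold Rdiv; ring. Qed.

(** * The M-Gauss series *)

Lemma Re_pos_not_nonpos_int (z : C) : (0 < Re z)%R -> ~ nonpos_int z.
Proof.
  intros H [k ->]; simpl in H; pose proof (pos_INR k); lra.
Qed.

Definition MGauss_coeff (kappa mu : list C)
    (alpha beta lambda1 lambda2 lambda3 rho : C) (k : nat) : C :=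
  rising lambda1 k
  * (MBeta kappa mu alpha beta (lambda2 + RtoC (INR k)) (lambda3 - lambda2) rho
     / CBeta lambda2 (lambda3 - lambda2))
  / RtoC (INR (fact k)).

Lemma MGauss_term_coeff (kappa mu : list C)
    (alpha beta lambda1 lambda2 lambda3 rho z : C) (k : nat) :
  MGauss_term kappa mu alpha beta lambda1 lambda2 lambda3 z rho k =
  MGauss_coeff kappa mu alpha beta lambda1 lambda2 lambda3 rho k * z ^ k.
Proof.
  unfold MGauss_term, MGauss_coeff; rewrite pochhammer_rising; unfold Cdiv; ring.
Qed.

(* If [B(lambda2, lambda3 - lambda2)] were zero, so would be the shifted Beta value,
   and both sides would vanish since [/ 0 = 0]; so it need not be shown nonzero. *)
Lemma CBeta_inv_rising (x y : C) (n : nat) :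
  (0 < Re x)%R -> (0 < Re y)%R ->
  rising x n / rising (x + y) n / CBeta (x + RtoC (INR n)) y = / CBeta x y.
Proof.
  intros Hx Hy; pose proof (CBeta_rising x y n Hx Hy) as E.
  assert (Hxn : rising x n <> 0) by now apply rising_neq_0, Re_pos_not_nonpos_int.
  assert (Hyn : rising (x + y) n <> 0)
    by (apply rising_neq_0, Re_pos_not_nonpos_int; destruct x, y; simpl in *; lra).
  replace (CBeta (x + RtoC (INR n)) y) with (rising x n / rising (x + y) n * CBeta x y).
  - destruct (classic (CBeta x y = 0)) as [E0|E0].
    + rewrite E0, Cmult_0_r; unfold Cdiv; rewrite Cinv_0; ring.
    + field; tauto.
  - replace (rising x n / rising (x + y) n * CBeta x y) with
      (rising x n * CBeta x y / rising (x + y) n) by (unfold Cdiv; ring).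
    rewrite <- E; field; assumption.
Qed.

(** [rising_plus] merges the two factors in [lambda1], [CBeta_inv_rising] absorbs the quotient of
    the symbols in [lambda2] and [lambda3], and (n + k)!/k! comes from differentiating. *)
Lemma MGauss_term_shift (kappa mu : list C)
    (alpha beta lambda1 lambda2 lambda3 rho z : C) (n k : nat) :
  (0 < Re lambda2)%R -> (Re lambda2 < Re lambda3)%R ->
  pochhammer lambda1 n * pochhammer lambda2 n / pochhammer lambda3 n
  * MGauss_term kappa mu alpha beta
      (lambda1 + RtoC (INR n)) (lambda2 + RtoC (INR n)) (lambda3 + RtoC (INR n)) z rho k
  = Nat.iter n derive_coeff
      (MGauss_coeff kappa mu alpha beta lambda1 lambda2 lambda3 rho) k * z ^ k.
Proof.
  intros H2 H3.
  rewrite iter_derive_coeff, MGauss_term_coeff; unfold MGauss_coeff.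
  rewrite !pochhammer_rising.
  replace (lambda2 + RtoC (INR n) + RtoC (INR k)) with (lambda2 + RtoC (INR (k + n)))
    by (rewrite plus_INR, RtoC_plus; ring).
  replace (lambda3 + RtoC (INR n) - (lambda2 + RtoC (INR n))) with (lambda3 - lambda2)
    by ring.
  pose proof (CBeta_inv_rising lambda2 (lambda3 - lambda2) n H2) as E.
  replace (lambda2 + (lambda3 - lambda2)) with lambda3 in E by ring.
  unfold Cdiv in *; rewrite <- E by (destruct lambda2, lambda3; simpl in *; lra).
  rewrite (Nat.add_comm k n), rising_plus.
  pose proof (RtoC_INR_fact_neq_0 (n + k)) as F.
  set (x := RtoC (INR (fact (n + k)))) in *.
  set (y := / RtoC (INR (fact k))).
  (* With these inverses as atoms, only (n + k)! remains to be cancelled. *)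
  set (b := / CBeta _ _); set (c := / rising lambda3 n).
  field; exact F.
Qed.

(** If (lambda1)_n = 0, the original series is a polynomial in z and gives no information on
    convergence of the shifted one; hence the condition on the first conclusion. *)
Theorem theorem4p9
  (p q : nat) (kappa mu : list C)
  (alpha beta lambda1 lambda2 lambda3 rho z : C) (n : nat)
  (hp : length kappa = p) (hq : length mu = q)
  (hkappa : List.Forall (fun k => ~ nonpos_int k) kappa)
  (hmu : List.Forall (fun m => ~ nonpos_int m) mu)
  (halpha : (0 < Re alpha)%R)
  (hlambda2 : (0 < Re lambda2)%R)
  (hlambda3 : (Re lambda2 < Re lambda3)%R)
  (hrho : (0 < Re rho)%R)
  (hdef : locally z (fun w =>
     MGauss_defined kappa mu alpha beta lambda1 lambda2 lambda3 w rho)) :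
  (pochhammer lambda1 n <> 0 ->
   MGauss_defined kappa mu alpha beta
     (lambda1 + RtoC (INR n)) (lambda2 + RtoC (INR n)) (lambda3 + RtoC (INR n))
     z rho) /\
  is_C_derive_n
    (fun w => MGauss kappa mu alpha beta lambda1 lambda2 lambda3 w rho) n z
    (pochhammer lambda1 n * pochhammer lambda2 n / pochhammer lambda3 n
     * MGauss kappa mu alpha beta
         (lambda1 + RtoC (INR n)) (lambda2 + RtoC (INR n))
         (lambda3 + RtoC (INR n)) z rho).
Proof.
  destruct (locally_C_farther_point z _ hdef) as [w0 [Hw0 [_ Hw0s]]].
  destruct (locally_singleton z _ hdef) as [HMB _].
  set (a := MGauss_coeff kappa mu alpha beta lambda1 lambda2 lambda3 rho).
  assert (Ha : abs_summable_below a (Cmod w0)).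
  { apply abs_summable_below_of_ex_series.
    revert Hw0s; apply (ex_series_ext (V := C_NormedModule)); intros k.
    apply MGauss_term_coeff. }
  pose proof (is_C_derive_n_Cpower_series a (Cmod w0) n z Ha Hw0) as HD.
  assert (Hn : abs_summable_below (Nat.iter n derive_coeff a) (Cmod w0))
    by now apply abs_summable_below_iter_derive_coeff.
  pose proof (is_series_Cpower_series _ _ z Hn Hw0) as HS.
  set (P := pochhammer lambda1 n * pochhammer lambda2 n / pochhammer lambda3 n).
  assert (HT : forall k, P * MGauss_term kappa mu alpha beta
      (lambda1 + RtoC (INR n)) (lambda2 + RtoC (INR n)) (lambda3 + RtoC (INR n)) z rho k
    = Nat.iter n derive_coeff a k * z ^ k)
    by (intros k; now apply MGauss_term_shift).
  (* The other two symbols are nonzero because [lambda2] and [lambda3] have positive real part. *)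
  assert (P0 : pochhammer lambda1 n <> 0 -> P <> 0).
  { intros H; unfold P, Cdiv; rewrite !pochhammer_rising in *.
    repeat apply Cmult_neq_0; trivial.
    - now apply rising_neq_0, Re_pos_not_nonpos_int.
    - apply Cinv_neq_0, rising_neq_0, Re_pos_not_nonpos_int; lra. }
  assert (HS' : P <> 0 -> is_series (V := C_NormedModule)
      (MGauss_term kappa mu alpha beta
         (lambda1 + RtoC (INR n)) (lambda2 + RtoC (INR n)) (lambda3 + RtoC (INR n)) z rho)
      (/ P * Cpower_series (Nat.iter n derive_coeff a) z)).
  { intros HP; apply (is_series_ext (V := C_NormedModule)
      (fun k => / P * (Nat.iter n derive_coeff a k * z ^ k))).
    - intros k; rewrite <- HT, Cmult_assoc, Cinv_l by assumption; apply Cmult_1_l.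
    - exact (is_series_scal (V := C_NormedModule) (/ P) _ _ HS). }
  split.
  - intros H; split.
    + intros k.
      replace (lambda2 + RtoC (INR n) + RtoC (INR k)) with (lambda2 + RtoC (INR (n + k)))
        by (rewrite plus_INR, RtoC_plus; ring).
      replace (lambda3 + RtoC (INR n) - (lambda2 + RtoC (INR n))) with (lambda3 - lambda2)
        by ring.
      apply HMB.
    + eexists; exact (HS' (P0 H)).
  - replace (P * _) with (Cpower_series (Nat.iter n derive_coeff a) z).
    + revert HD; apply is_C_derive_n_ext; intros w.
      apply CSeries_ext; intros k; symmetry; apply MGauss_term_coeff.
    (* If [P] is zero, [HT] makes every term of the differentiated series vanish, so both sides are
       0; otherwise [P] can be divided out. *)
    + destruct (classic (P = 0)) as [E|E].
      * rewrite E, Cmult_0_l.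
        replace (RtoC 0) with (0 * Cpower_series (Nat.iter n derive_coeff a) z) by ring.
        apply CSeries_unique, (is_series_ext (V := C_NormedModule)
          (fun k => 0 * (Nat.iter n derive_coeff a k * z ^ k))).
        -- intros k; rewrite <- HT, E, !Cmult_0_l; reflexivity.
        -- exact (is_series_scal (V := C_NormedModule) (RtoC 0) _ _ HS).
      * unfold MGauss; rewrite (CSeries_unique _ _ (HS' E)).
        rewrite Cmult_assoc, Cinv_r by assumption; symmetry; apply Cmult_1_l.
Qed.
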